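(* Let $\tfrac12\le\theta<1$, let $\Gamma_1\subset T^*\mathbb{R}^{d_1}\setminus\{0\}$ and $\Gamma_2\subset T^*\mathbb{R}^{d_2}\setminus\{0\}$ be closed cones, and let $u\in\mathcal{S}'_{\theta,\Gamma_1}(\mathbb{R}^{d_1})$, $v\in\mathcal{S}'_{\theta,\Gamma_2}(\mathbb{R}^{d_2})$. Define $$\Gamma=\big((\Gamma_1\cup\{0\})\times(\Gamma_2\cup\{0\})\big)\setminus\{(0,0)\}\subset T^*\mathbb{R}^{d_1+d_2},$$ where $T^*\mathbb{R}^{d_1}\times T^*\mathbb{R}^{d_2}$ is identified with $T^*\mathbb{R}^{d_1+d_2}$ via $((x,\xi),(y,\eta))\mapsto(x,y,\xi,\eta)$. Then $u\otimes v\in\mathcal{S}'_{\theta,\Gamma}(\mathbb{R}^{d_1+d_2})$.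
   Context: $\mathcal{S}_\theta(\mathbb{R}^d)$ is the union over $C>0$ of the Banach spaces of all $f\in C^\infty(\mathbb{R}^d)$ with $\sup_{\alpha,\beta\in\mathbb{N}^d}\sup_{x} C^{-|\alpha|-|\beta|}(\alpha!\,\beta!)^{-\theta}|x^\alpha\partial^\beta f(x)|<\infty$, with the inductive limit topology. $\mathcal{S}_\theta'(\mathbb{R}^d)$ is its topological dual; $\langle\cdot,\cdot\rangle$ is the bilinear duality pairing. $T^*\mathbb{R}^d$ is identified with $\mathbb{R}^{2d}$; a subset of $\mathbb{R}^{2d}\setminus\{0\}$ is conic (a cone) if it is invariant under multiplication of all $2d$ coordinates by positive reals; closed means closed in $\mathbb{R}^{2d}\setminus\{0\}$. Global wave front set: for $u\in\mathcal{S}_\theta'(\mathbb{R}^d)$, a point $(x_0,\xi_0)\in\mathbb{R}^{2d}\setminus\{0\}$ is not in $\mathrm{WF}^\theta_{\mathrm{gl}}(u)$ iff there are an open conic neighbourhood $\Gamma'$ of $(x_0,\xi_0)$ and $C,\varepsilon>0$ with $|\langle u_y, e^{-i\langle y,\xi\rangle-\frac12|y-x|^2}\rangle|\le C e^{-\varepsilon(|x|^{1/\theta}+|\xi|^{1/\theta})}$ for all $(x,\xi)\in\Gamma'$. For a closed cone $\Gamma\subset\mathbb{R}^{2d}\setminus\{0\}$, $\mathcal{S}'_{\theta,\Gamma}(\mathbb{R}^d)=\{u\in\mathcal{S}'_\theta(\mathbb{R}^d):\mathrm{WF}^\theta_{\mathrm{gl}}(u)\subset\Gamma\}$. *)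

(* Defs.v *)
From mathcomp Require Import all_boot all_order all_algebra.
From mathcomp Require Import complex.
From mathcomp Require Import all_classical all_reals all_analysis.

Set Implicit Arguments.
Unset Strict Implicit.
Unset Printing Implicit Defensive.
Import Order.TTheory GRing.Theory Num.Theory.
Import numFieldNormedType.Exports.
Import ComplexField.Normc.

Local Open Scope classical_set_scope.
Local Open Scope ring_scope.
Local Open Scope complex_scope.

(* 'rV[R]_d carries the topology of R^d, but its library norm is the sup norm;
   the Euclidean quantities are therefore spelled out. *)
Definition edot (R : realType) (d : nat) (x y : 'rV[R]_d) : R :=
  \sum_(i < d) x 0 i * y 0 i.

Definition enorm (R : realType) (d : nat) (x : 'rV[R]_d) : R :=
  Num.sqrt (edot x x).

(* The target R[i] is identified with R^2: differentiation and continuity of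
   complex-valued functions are taken on real and imaginary parts. *)
Definition cpartial (R : realType) (d : nat) (i : 'I_d)
    (f : 'rV[R]_d -> R[i]) : 'rV[R]_d -> R[i] :=
  fun x => 'D_(delta_mx 0 i) (fun y => complex.Re (f y) : R) x
        +i* 'D_(delta_mx 0 i) (fun y => complex.Im (f y) : R) x.

Definition csmooth (R : realType) (d : nat) (f : 'rV[R]_d -> R[i]) : Prop :=
  forall s : seq 'I_d, let g := foldr (@cpartial R d) f s in
    [/\ continuous (fun x => complex.Re (g x) : R),
        continuous (fun x => complex.Im (g x) : R) &
        forall (i : 'I_d) (x : 'rV[R]_d),
          derivable (fun y => complex.Re (g y) : R) x (delta_mx 0 i) /\
          derivable (fun y => complex.Im (g y) : R) x (delta_mx 0 i)].

Definition mi_deg (d : nat) (a : 'I_d -> nat) : nat := (\sum_(i < d) a i)%N.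

Definition mi_fact (d : nat) (a : 'I_d -> nat) : nat := (\prod_(i < d) (a i)`!)%N.

Definition monom (R : realType) (d : nat) (a : 'I_d -> nat) (x : 'rV[R]_d) : R :=
  \prod_(i < d) x 0 i ^+ a i.

Definition mderiv (R : realType) (d : nat) (b : 'I_d -> nat)
    (f : 'rV[R]_d -> R[i]) : 'rV[R]_d -> R[i] :=
  foldr (fun i g => iter (b i) (cpartial i) g) f (enum 'I_d).

Definition gs_norm (R : realType) (theta : R) (d : nat) (C : R)
    (f : 'rV[R]_d -> R[i]) : \bar R :=
  ereal_sup [set r : \bar R |
    exists (a b : 'I_d -> nat) (x : 'rV[R]_d),
      r = (C ^- (mi_deg a + mi_deg b)
           * (mi_fact a * mi_fact b)%:R `^ (- theta)
           * normc ((monom a x)%:C * mderiv b f x))%:E].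

Definition gs_step (R : realType) (theta : R) (d : nat) (C : R) :
    set ('rV[R]_d -> R[i]) :=
  [set f | csmooth f /\ (gs_norm theta C f < +oo)%E].

Definition gs_space (R : realType) (theta : R) (d : nat) :
    set ('rV[R]_d -> R[i]) :=
  [set f | exists2 C : R, 0 < C & gs_step theta C f].

Definition abs_convex (R : realType) (d : nat)
    (V : set ('rV[R]_d -> R[i])) : Prop :=
  forall (f g : 'rV[R]_d -> R[i]) (a b : R[i]), V f -> V g ->
    normc a + normc b <= 1 -> V (fun x => a * f x + b * g x).

(* Basic 0-neighbourhoods of the locally convex inductive limit of the Banach
   spaces gs_step theta C, C > 0: the absolutely convex sets whose trace on
   every step is a 0-neighbourhood of that step. *)
Definition gs_basic0 (R : realType) (theta : R) (d : nat)
    (V : set ('rV[R]_d -> R[i])) : Prop :=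
  [/\ V `<=` @gs_space R theta d, abs_convex V &
      forall C : R, 0 < C -> exists2 r : R, 0 < r &
        forall f, gs_step theta C f -> (gs_norm theta C f < r%:E)%E -> V f].

Definition gs_nbhs (R : realType) (theta : R) (d : nat)
    (f : 'rV[R]_d -> R[i]) : set_system ('rV[R]_d -> R[i]) :=
  [set A | exists2 V, gs_basic0 theta V &
    forall g, V g -> A (fun x => f x + g x)].

(* An ultradistribution is represented by a map on all functions
   'rV[R]_d -> R[i]; only its restriction to gs_space theta is meaningful, and
   its values elsewhere are unconstrained. *)
Definition gs_dual (R : realType) (theta : R) (d : nat) :
    set (('rV[R]_d -> R[i]) -> R[i]) :=
  [set u |
    (forall (f g : 'rV[R]_d -> R[i]) (a b : R[i]),
       gs_space theta f -> gs_space theta g ->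
       u (fun x => a * f x + b * g x) = a * u f + b * u g) /\
    (forall f, gs_space theta f -> forall e : R, 0 < e ->
       gs_nbhs theta f [set g | normc (u g - u f) < e])].

(* A covector (x, xi) of T^* R^d = R^(2d) is a pair of row vectors. *)
Definition conic (R : realType) (d : nat) (G : set ('rV[R]_d * 'rV[R]_d)) : Prop :=
  ~ G 0 /\ forall (t : R) p, 0 < t -> G p -> G (t *: p).

Definition closed_cone (R : realType) (d : nat)
    (G : set ('rV[R]_d * 'rV[R]_d)) : Prop :=
  conic G /\ exists2 F : set ('rV[R]_d * 'rV[R]_d), closed F & G = F `\` [set 0].

(* y |-> exp (- i <y, xi> - |y - x|^2 / 2) *)
Definition wave_packet (R : realType) (d : nat) (x xi : 'rV[R]_d) :
    'rV[R]_d -> R[i] :=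
  fun y => (expR (- (enorm (y - x) ^+ 2 / 2)))%:C
           * (cos (edot y xi) -i* sin (edot y xi)).

Definition WFgl (R : realType) (theta : R) (d : nat)
    (u : ('rV[R]_d -> R[i]) -> R[i]) : set ('rV[R]_d * 'rV[R]_d) :=
  [set p | p <> 0 /\
    ~ exists G : set ('rV[R]_d * 'rV[R]_d),
        [/\ open G, conic G, G p &
            exists C e : R, [/\ 0 < C, 0 < e &
              forall x xi, G (x, xi) ->
                normc (u (wave_packet x xi)) <=
                C * expR (- (e * (enorm x `^ theta^-1
                                  + enorm xi `^ theta^-1)))]]].

Definition gs_dual_wf (R : realType) (theta : R) (d : nat)
    (G : set ('rV[R]_d * 'rV[R]_d)) : set (('rV[R]_d -> R[i]) -> R[i]) :=
  [set u | gs_dual theta u /\ WFgl theta u `<=` G].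

(* <u (x) v, f> = <u_x, <v_y, f(x, y)>> *)
Definition tensor (R : realType) (d1 d2 : nat)
    (u : ('rV[R]_d1 -> R[i]) -> R[i]) (v : ('rV[R]_d2 -> R[i]) -> R[i]) :
    ('rV[R]_(d1 + d2) -> R[i]) -> R[i] :=
  fun f => u (fun x => v (fun y => f (row_mx x y))).

Lemma tensorE (R : realType) (theta : R) (d1 d2 : nat)
    (u : ('rV[R]_d1 -> R[i]) -> R[i]) (v : ('rV[R]_d2 -> R[i]) -> R[i])
    (f : 'rV[R]_d1 -> R[i]) (g : 'rV[R]_d2 -> R[i]) :
  gs_dual theta u -> gs_dual theta v ->
  gs_space theta f -> gs_space theta g ->
  tensor u v (fun z => f (lsubmx z) * g (rsubmx z)) = u f * v g.
Proof.
move=> [ul _] [vl _] fS gS; rewrite /tensor.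
under eq_fun => x do under eq_fun => y do rewrite row_mxKl row_mxKr.
have -> : (fun x => v (fun y => f x * g y)) = (fun x => v g * f x + 0 * f x).
  apply/funext => x; rewrite mul0r addr0 mulrC.
  have := vl g g (f x) 0 gS gS; rewrite mul0r addr0 => <-.
  by congr v; apply/funext => y; rewrite mul0r addr0.
by rewrite ul// mul0r addr0 mulrC.
Qed.

(* The identification T^*R^d1 x T^*R^d2 = T^*R^(d1+d2). *)
Definition cotangent_merge (R : realType) (d1 d2 : nat)
    (p : ('rV[R]_d1 * 'rV[R]_d1) * ('rV[R]_d2 * 'rV[R]_d2)) :
    'rV[R]_(d1 + d2) * 'rV[R]_(d1 + d2) :=
  (row_mx p.1.1 p.2.1, row_mx p.1.2 p.2.2).

Definition cone_prod (R : realType) (d1 d2 : nat)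
    (G1 : set ('rV[R]_d1 * 'rV[R]_d1)) (G2 : set ('rV[R]_d2 * 'rV[R]_d2)) :
    set ('rV[R]_(d1 + d2) * 'rV[R]_(d1 + d2)) :=
  (@cotangent_merge R d1 d2 @` ((G1 `|` [set 0]) `*` (G2 `|` [set 0]))) `\` [set 0].

(* Main.v *)
(* If p = (p1, p2) lies outside Gamma, then one of its components, say p1, is
   neither 0 nor in Gamma_1. The wave packet on R^(d1 + d2) is the product of
   the wave packets on the two factors, so u (x) v is tested by a product: the
   first factor decays like exp (- e (|x|^(1/theta) + |xi|^(1/theta))) on a conic
   neighbourhood of p1, and the second grows at most like
   exp (delta (|y|^(1/theta) + |eta|^(1/theta))) for every delta > 0, because v
   is bounded on each Banach step and theta >= 1/2. On a cone where
   |p2| < K |p1| the decay wins.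
   That u (x) v is continuous follows from the fact that x |-> <v_y, f(x, y)> has
   the derivatives <v_y, d_x^b f(x, y)> and stays in the step of f; this needs the
   symmetry of mixed partial derivatives. *)
Require Import Defs.
From mathcomp Require Import all_boot all_order all_algebra.
From mathcomp Require Import complex.
From mathcomp Require Import all_classical all_reals all_analysis.
From mathcomp Require Import ring lra.
Import Order.TTheory GRing.Theory Num.Theory.
Import numFieldNormedType.Exports.
Import ComplexField.Normc.
Set Implicit Arguments.
Unset Strict Implicit.
Unset Printing Implicit Defensive.
Local Open Scope classical_set_scope.
Local Open Scope ring_scope.
Local Open Scope complex_scope.

(** * Derivatives along a line *)

(** Continuity for [gs_nbhs] is traded for boundedness on every step, and the norm of a step for a
    bounded family of derivatives ([gs_jet]) in which differentiation only has to link neighbouring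
    multi-indices. Such families can be written down for wave packets, by the Hermite recursion, and
    for x |-> <v_y, f(x, y)>, by slices of the derivatives of f. The delicate point is to
    differentiate under v: the remainder of a difference quotient in x has to be small in the norm
    of a step, for all weights in y at once. A quantitative mean value estimate gives O(|h|) with
    the weight of a second derivative in x. Since degrees and factorials split over the two groups
    of variables, no larger C is needed. The growth of v on packets is a trade between step and
    exponent. A power r^n is at most h^-n n!^theta exp(theta (h r)^(1/theta)) for each h > 0: a
    small h makes the exponent small and C large, which is allowed because v has a bound on every
    step. The Gaussian itself only produces n!^(1/2), which theta >= 1/2 absorbs. *)

Section LineDerivative.
Context {R : realType} {V : normedModType R}.
Implicit Types (f : V -> R) (x v : V).

Lemma is_derive_line f x v (df : R) :
  is_derive x v f df <-> is_derive (0 : R) 1 (fun h => f (h *: v + x)) df.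
Proof.
have E : (fun h : R => h^-1 *: ((f \o shift x) (h *: v) - f x)) =
  (fun h : R => h^-1 *: (((fun h => f (h *: v + x)) \o shift 0) (h *: 1)
     - (fun h => f (h *: v + x)) 0)).
  by apply/funext => h; rewrite /= addr0 scale0r add0r /GRing.scale /= mulr1.
by split => -[d1 d2]; split; rewrite /derivable /derive ?E // -?E.
Qed.

Lemma is_derive_along f x v (df : V -> R) :
  (forall y, is_derive y v f (df y)) ->
  forall t : R, is_derive t 1 (fun h => f (h *: v + x)) (df (t *: v + x)).
Proof.
move=> H t; have [d1 d2] := H (t *: v + x).
have E : (fun h : R => h^-1 *: (((fun h => f (h *: v + x)) \o shift t) (h *: 1)
     - (fun h => f (h *: v + x)) t)) =
  (fun h : R => h^-1 *: ((f \o shift (t *: v + x)) (h *: v) - f (t *: v + x))).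
  apply/funext => h; rewrite /= addrA -scalerDl.
  by rewrite [h *: 1]mulr1.
by split; rewrite /derivable /derive ?E // -?E.
Qed.

Lemma is_derive_cst_along f x v :
  (forall h : R, f (h *: v + x) = f x) -> is_derive x v f 0.
Proof.
move=> H; apply/is_derive_line; under eq_fun => h do rewrite H.
exact: is_derive_cst.
Qed.

(** No order is imposed on [a] and [b], because the increments of difference quotients take both
    signs. *)
Lemma MVT_everywhere (phi dphi : R -> R) (a b : R) :
  (forall t : R, is_derive t 1 phi (dphi t)) ->
  exists2 c, `|c - a| <= `|b - a| & phi b - phi a = dphi c * (b - a).
Proof.
move=> H.
have C : continuous phi.
  by move=> t; apply/differentiable_continuous/derivable1_diffP; case: (H t).
have CW a' b' : {within `[a', b'], continuous phi} by exact: continuous_subspaceT.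
have [ab|ba] := leP a b.
  have [c] := @MVT_segment _ phi dphi a b ab (fun t _ => H t) (CW _ _).
  rewrite in_itv /= => /andP[ac cb] E; exists c => //.
  by rewrite !ger0_norm ?subr_ge0 // lerD2r.
have [c] := @MVT_segment _ phi dphi b a (ltW ba) (fun t _ => H t) (CW _ _).
rewrite in_itv /= => /andP[ac cb] E; exists c.
  by rewrite !ler0_norm ?subr_le0 ?(ltW ba) // lerN2 lerD2r.
by rewrite -opprB E -mulrN opprB.
Qed.

(** Two uses of the mean value theorem replace Taylor's formula; the lost factor 1/2 is irrelevant.
    What counts is an explicit rate depending only on a bound for the second derivative, since it
    must later hold uniformly over all weights. *)
Lemma quotient_remainder (phi dphi ddphi : R -> R) (B h : R) :
  (forall t : R, is_derive t 1 phi (dphi t)) ->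
  (forall t : R, is_derive t 1 dphi (ddphi t)) ->
  (forall t, `|ddphi t| <= B) -> h != 0 ->
  `|h^-1 * (phi h - phi 0) - dphi 0| <= B * `|h|.
Proof.
move=> H1 H2 HB h0.
have [c] := @MVT_everywhere phi dphi 0 h H1.
rewrite !subr0 => ch ->; rewrite mulrCA mulVf // mulr1.
have [e] := @MVT_everywhere dphi ddphi 0 c H2.
rewrite !subr0 => ec ->; rewrite normrM.
by apply: ler_pM => //; exact: HB.
Qed.

(** The mean value theorem is applied in direction [v] to the difference of two translates of [f],
    then in direction [w] to [dv]. The second difference is symmetric in [v] and [w], so exchanging
    them expresses the same number by the other mixed derivative; this is the core of [clairaut]. *)
Lemma second_difference f x v w (dv dwv : V -> R) (h : R) :
  (forall y, is_derive y v f (dv y)) -> (forall y, is_derive y w dv (dwv y)) ->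
  exists s t, [/\ `|s| <= `|h|, `|t| <= `|h| &
    f (h *: v + (h *: w + x)) - f (h *: w + x) - f (h *: v + x) + f x
    = dwv (t *: w + (s *: v + x)) * h ^+ 2].
Proof.
move=> H1 H2.
pose phi k := f (k *: v + (h *: w + x)) - f (k *: v + x).
pose dphi k := dv (k *: v + (h *: w + x)) - dv (k *: v + x).
have Hphi (k : R) : is_derive k 1 phi (dphi k).
  by apply: is_deriveB; apply: is_derive_along.
have [s] := @MVT_everywhere phi dphi 0 h Hphi.
rewrite !subr0 => sh E.
have [t] := @MVT_everywhere (fun k => dv (k *: w + (s *: v + x))) _ 0 h
  (is_derive_along (s *: v + x) H2).
rewrite !subr0 => th E'; exists s, t; split => //.
rewrite expr2 mulrA -E' !scale0r !add0r.
have -> : h *: w + (s *: v + x) = s *: v + (h *: w + x) by rewrite addrCA.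
move: E; rewrite /phi /dphi !scale0r !add0r => <-; ring.
Qed.

Lemma clairaut f x v w (dv dw dwv dvw : V -> R) :
  (forall y, is_derive y v f (dv y)) -> (forall y, is_derive y w dv (dwv y)) ->
  (forall y, is_derive y w f (dw y)) -> (forall y, is_derive y v dw (dvw y)) ->
  {for x, continuous dwv} -> {for x, continuous dvw} -> dwv x = dvw x.
Proof.
move=> H1 H2 H3 H4 C1 C2; apply/eqP; rewrite -subr_eq0 -normr_le0.
apply/ler_addgt0Pr => e e0; rewrite add0r.
have e2 : 0 < e / 2 by rewrite divr_gt0.
have /cvgr_dist_lt /(_ _ e2) N1 := C1.
have /cvgr_dist_lt /(_ _ e2) N2 := C2.
have /nbhs_ballP : nbhs x [set y | `|dwv x - dwv y| < e / 2 /\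
    `|dvw x - dvw y| < e / 2] by exact: filterI.
move=> [r /= r0 Hr].
(* The sampled points lie within h (|v| + |w|) of [x], which is below [r]; the summand 1 keeps [m]
   positive when both directions vanish. *)
pose m := `|v| + `|w| + 1.
have m0 : 0 < m by rewrite ltr_wpDl // addr_ge0.
pose h := r / (2 * m).
have h0 : 0 < h by rewrite divr_gt0 // mulr_gt0.
have small s t : `|s| <= `|h| -> `|t| <= `|h| -> ball x r (t *: w + (s *: v + x)).
  move=> sh th; rewrite -ball_normE /= !opprD addrCA [x + _]addrCA subrr addr0.
  rewrite -opprD normrN.
  apply: le_lt_trans (ler_normD _ _) _; rewrite !normrZ.
  apply: (@le_lt_trans _ _ (h * `|w| + h * `|v|)).
    by apply: lerD; apply: ler_wpM2r => //; rewrite -[leRHS]gtr0_norm.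
  rewrite -mulrDr /h mulrAC ltr_pdivrMr ?mulr_gt0 // ltr_pM2l //.
  rewrite /m; have := normr_ge0 v; have := normr_ge0 w; lra.
have [s [t [sh th E]]] := second_difference x h H1 H2.
have [s' [t' [sh' th' E']]] := second_difference x h H3 H4.
have EE : dwv (t *: w + (s *: v + x)) = dvw (t' *: v + (s' *: w + x)).
  have h20 : h ^+ 2 != 0 by rewrite expf_neq0 // gt_eqF.
  apply: (mulIf h20); rewrite -E -E'.
  rewrite [h *: v + (h *: w + x)]addrCA; ring.
have [/= L1 _] := Hr _ (small _ _ sh th).
have S : ball x r (t' *: v + (s' *: w + x)).
  by have := small _ _ th' sh'; rewrite addrCA.
have [/= _ L2] := Hr _ S.
rewrite -EE in L2.
set q := dwv (_ + _) in L1 L2.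
have -> : dwv x - dvw x = (dwv x - q) - (dvw x - q) by ring.
by apply: le_trans (ler_normB _ _) _; rewrite [leRHS](splitr e) lerD // ltW.
Qed.

End LineDerivative.

(** * Complex-valued functions *)

Section ComplexModulus.
Context {R : realType}.
Implicit Types (z w : R[i]) (r : R).

Lemma normc_ge0 z : 0 <= normc z.
Proof. by case: z => a b; exact: sqrtr_ge0. Qed.

Lemma normc_real r : normc r%:C = `|r|.
Proof. by rewrite /normc /= expr0n /= addr0 sqrtr_sqr. Qed.

Lemma normc_imag r : normc (0 +i* r) = `|r|.
Proof. by rewrite /normc /= expr0n /= add0r sqrtr_sqr. Qed.

Lemma normcB z w : normc (z - w) <= normc z + normc w.
Proof. by rewrite -(normcN w); exact: le_normcD. Qed.

Lemma normRe_le z : `|complex.Re z| <= normc z.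
Proof.
by case: z => a b /=; rewrite -sqrtr_sqr ler_wsqrtr // lerDl sqr_ge0.
Qed.

Lemma normIm_le z : `|complex.Im z| <= normc z.
Proof.
by case: z => a b /=; rewrite -sqrtr_sqr ler_wsqrtr // lerDr sqr_ge0.
Qed.

Lemma normc_le_ReIm z : normc z <= `|complex.Re z| + `|complex.Im z|.
Proof.
case: z => a b; have {1}-> : a +i* b = a%:C + (0 +i* b).
  by apply/eqP; rewrite eq_complex /= addr0 add0r !eqxx.
by apply: le_trans (le_normcD _ _) _; rewrite normc_real normc_imag.
Qed.

Lemma complex_ReM z w :
  complex.Re (z * w) = complex.Re z * complex.Re w - complex.Im z * complex.Im w.
Proof. by case: z w => a b [c e]. Qed.

Lemma complex_ImM z w :
  complex.Im (z * w) = complex.Re z * complex.Im w + complex.Im z * complex.Re w.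
Proof. by case: z w => a b [c e]. Qed.

Lemma complex_ReD z w : complex.Re (z + w) = complex.Re z + complex.Re w.
Proof. by case: z w => a b [c e]. Qed.

Lemma complex_ImD z w : complex.Im (z + w) = complex.Im z + complex.Im w.
Proof. by case: z w => a b [c e]. Qed.

Lemma complex_ReN z : complex.Re (- z) = - complex.Re z.
Proof. by case: z. Qed.

Lemma complex_ImN z : complex.Im (- z) = - complex.Im z.
Proof. by case: z. Qed.

End ComplexModulus.

Section ComplexDerivative.
Context {R : realType} {V : normedModType R}.
Implicit Types (f g : V -> R[i]) (x v : V).

Definition is_cderive f x v (df : R[i]) : Prop :=
  is_derive x v (fun y => complex.Re (f y)) (complex.Re df) /\
  is_derive x v (fun y => complex.Im (f y)) (complex.Im df).

Lemma is_cderiveM f g x v df dg : is_cderive f x v df -> is_cderive g x v dg ->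
  is_cderive (fun y => f y * g y) x v (df * g x + f x * dg).
Proof.
move=> [f1 f2] [g1 g2]; split.
  under [X in is_derive _ _ X]eq_fun => y do rewrite complex_ReM.
  apply: (is_derive_eq (is_deriveB (is_deriveM f1 g1) (is_deriveM f2 g2))).
  rewrite complex_ReD !complex_ReM /GRing.scale /=; ring.
under [X in is_derive _ _ X]eq_fun => y do rewrite complex_ImM.
apply: (is_derive_eq (is_deriveD (is_deriveM f1 g2) (is_deriveM f2 g1))).
rewrite complex_ImD !complex_ImM /GRing.scale /=; ring.
Qed.

Lemma is_cderiveD f g x v df dg : is_cderive f x v df -> is_cderive g x v dg ->
  is_cderive (fun y => f y + g y) x v (df + dg).
Proof.
move=> [f1 f2] [g1 g2]; split.
  under [X in is_derive _ _ X]eq_fun => y do rewrite complex_ReD.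
  by rewrite complex_ReD; apply: is_deriveD.
under [X in is_derive _ _ X]eq_fun => y do rewrite complex_ImD.
by rewrite complex_ImD; apply: is_deriveD.
Qed.

Lemma is_cderive_cst_along f x v :
  (forall h : R, f (h *: v + x) = f x) -> is_cderive f x v 0.
Proof.
by move=> H; split; apply: is_derive_cst_along => h; rewrite H.
Qed.

Lemma is_cderiveZ a f x v df : is_cderive f x v df ->
  is_cderive (fun y => a * f y) x v (a * df).
Proof.
move=> H; have C : is_cderive (fun _ : V => a) x v 0 by exact: is_cderive_cst_along.
by have := is_cderiveM C H; rewrite mul0r add0r.
Qed.

Lemma is_cderive_lin a b f g x v df dg :
  is_cderive f x v df -> is_cderive g x v dg ->
  is_cderive (fun y => a * f y + b * g y) x v (a * df + b * dg).
Proof. by move=> Hf Hg; apply: is_cderiveD; exact: is_cderiveZ. Qed.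

Lemma is_cderive_along f x v (df : V -> R[i]) :
  (forall y, is_cderive f y v (df y)) ->
  forall t : R, is_derive t 1 (fun h => complex.Re (f (h *: v + x)))
      (complex.Re (df (t *: v + x)))
    /\ is_derive t 1 (fun h => complex.Im (f (h *: v + x)))
      (complex.Im (df (t *: v + x))).
Proof.
move=> H t; split.
  exact: (@is_derive_along R V (fun y => complex.Re (f y)) x v
    (fun y => complex.Re (df y)) (fun y => (H y).1) t).
exact: (@is_derive_along R V (fun y => complex.Im (f y)) x v
    (fun y => complex.Im (df y)) (fun y => (H y).2) t).
Qed.

(** The hypothesis is a rate rather than a limit, because a rate is what a bounded functional yields
    when it is applied to the remainder of a difference quotient. *)
Lemma is_cderive_of_quotient f x v df (K : R) :
  (forall h : R, h != 0 ->
     normc ((h^-1)%:C * (f (h *: v + x) - f x) - df) <= K * `|h|) ->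
  is_cderive f x v df.
Proof.
move=> H.
have aux (g : V -> R) (dg : R) : (forall h : R, h != 0 ->
    `|h^-1 * (g (h *: v + x) - g x) - dg| <= K * `|h|) -> is_derive x v g dg.
  move=> Hg.
  suff L : (fun h : R => h^-1 *: ((g \o shift x) (h *: v) - g x)) @ 0^' --> dg.
    by split; [apply/cvg_ex; exists dg|exact/cvg_lim].
  apply/cvgrPdist_le => e e0; near=> h.
  rewrite distrC; apply: le_trans (Hg h _) _; first by near: h; exact: nbhs_dnbhs_neq.
  apply: (@le_trans _ _ ((`|K| + 1) * `|h|)).
    by apply: ler_wpM2r => //; rewrite ler_wpDr // ler_norm.
  rewrite -ler_pdivlMl ?ltr_wpDl //.
  near: h; apply: dnbhs0_le.
  by rewrite mulr_gt0 // invr_gt0 ltr_wpDl.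
split; apply: aux => h h0.
  apply: le_trans (H h h0); apply: le_trans (normRe_le _).
  by rewrite !(complex_ReD, complex_ReN, complex_ReM) /= mul0r subr0.
apply: le_trans (H h h0); apply: le_trans (normIm_le _).
rewrite !(complex_ImD, complex_ImN, complex_ImM, complex_ReD, complex_ReN, complex_ReM).
by rewrite /= mul0r addr0.
Unshelve. all: by end_near. Qed.

End ComplexDerivative.

(** * Derivative families of Gelfand-Shilov functions *)

Section MultiIndex.
Variable d : nat.
Implicit Types (a b c : 'I_d -> nat) (i j : 'I_d) (r : seq 'I_d).

Definition mi0 : 'I_d -> nat := fun _ => 0%N.

Definition mi_succ i b : 'I_d -> nat := fun j => (b j + (j == i))%N.

Lemma mi_fact_gt0 a : (0 < mi_fact a)%N.
Proof. by rewrite prodn_gt0 // => i; exact: fact_gt0. Qed.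

Lemma mi_foldE b c r : uniq r ->
  foldr (fun i e => iter (b i) (mi_succ i) e) c r =
  fun j => (c j + (if j \in r then b j else 0))%N.
Proof.
have iterE n i e : iter n (mi_succ i) e = fun j => (e j + (if j == i then n else 0))%N.
  elim: n => [|n IHn] /=; first by apply/funext => j; rewrite if_same addn0.
  rewrite IHn; apply/funext => j; rewrite /mi_succ.
  by case: eqP => _; rewrite ?addn0 // addn1 addnS.
elim: r => [_|i r IHr /= /andP[ir ur]] /=.
  by apply/funext => j; rewrite addn0.
rewrite iterE IHr //; apply/funext => j; rewrite inE -addnA; congr addn.
have [->|_] := eqVneq j i; first by rewrite (negbTE ir).
by rewrite addn0.
Qed.

(** The fold that defines [mderiv], run on multi-indices instead of functions, ends in [b]. This
    identifies [mderiv b f] with the member [D b] of a derivative family. *)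
Lemma mi_fold_enum b :
  foldr (fun i e => iter (b i) (mi_succ i) e) mi0 (enum 'I_d) = b.
Proof.
by rewrite mi_foldE ?enum_uniq //; apply/funext => j; rewrite mem_enum.
Qed.

End MultiIndex.

Section Smooth.
Context {R : realType} {d : nat}.
Implicit Types (f : 'rV[R]_d -> R[i]) (i j : 'I_d) (b : 'I_d -> nat).

Lemma csmooth_partial f i : csmooth f -> csmooth (cpartial i f).
Proof. by move=> H s; have := H (rcons s i); rewrite foldr_rcons. Qed.

Lemma csmooth_cderive f i x : csmooth f ->
  is_cderive f x (delta_mx 0 i) (cpartial i f x).
Proof.
by move=> /(_ [::]) [_ _ /(_ i x) [d1 d2]]; split; apply: DeriveDef.
Qed.

Lemma is_cderive_partial f (g : 'rV[R]_d -> R[i]) i :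
  (forall x, is_cderive f x (delta_mx 0 i) (g x)) -> cpartial i f = g.
Proof.
move=> H; apply/funext => x; case: (H x) => -[_ h1] [_ h2].
by rewrite /cpartial h1 h2; case: (g x).
Qed.

Lemma cpartialC f i j : csmooth f ->
  cpartial i (cpartial j f) = cpartial j (cpartial i f).
Proof.
move=> S; have Si := csmooth_partial i S; have Sj := csmooth_partial j S.
have Sij := csmooth_partial i Sj; have Sji := csmooth_partial j Si.
apply/funext => x; apply/eqP; rewrite eq_complex; apply/andP; split; apply/eqP.
  apply: (@clairaut R _ (fun y => complex.Re (f y)) x (delta_mx 0 j) (delta_mx 0 i)
    (fun y => complex.Re (cpartial j f y)) (fun y => complex.Re (cpartial i f y))
    (fun y => complex.Re (cpartial i (cpartial j f) y))
    (fun y => complex.Re (cpartial j (cpartial i f) y))) => [y|y|y|y||].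
  - by have [] := csmooth_cderive j y S.
  - by have [] := csmooth_cderive i y Sj.
  - by have [] := csmooth_cderive i y S.
  - by have [] := csmooth_cderive j y Si.
  - by have [c _ _] := Sij [::]; exact: c.
  - by have [c _ _] := Sji [::]; exact: c.
apply: (@clairaut R _ (fun y => complex.Im (f y)) x (delta_mx 0 j) (delta_mx 0 i)
  (fun y => complex.Im (cpartial j f y)) (fun y => complex.Im (cpartial i f y))
  (fun y => complex.Im (cpartial i (cpartial j f) y))
  (fun y => complex.Im (cpartial j (cpartial i f) y))) => [y|y|y|y||].
- by have [] := csmooth_cderive j y S.
- by have [] := csmooth_cderive i y Sj.
- by have [] := csmooth_cderive i y S.
- by have [] := csmooth_cderive j y Si.
- by have [_ c _] := Sij [::]; exact: c.
- by have [_ c _] := Sji [::]; exact: c.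
Qed.

Lemma csmooth_iter f i n : csmooth f -> csmooth (iter n (cpartial i) f).
Proof. by move=> S; elim: n => //= n; exact: csmooth_partial. Qed.

Lemma cpartial_iter f i j n : csmooth f ->
  cpartial i (iter n (cpartial j) f) = iter n (cpartial j) (cpartial i f).
Proof.
move=> S; elim: n => //= n <-; apply: cpartialC; exact: csmooth_iter.
Qed.

(** [mderiv] differentiates in the fixed order of [enum 'I_d], so an outer derivative in direction
    [i] must be moved past the coordinates listed before [i]. This is where the symmetry of mixed
    partial derivatives is needed. *)
Lemma cpartial_mderiv f i b : csmooth f ->
  cpartial i (mderiv b f) = mderiv (mi_succ i b) f.
Proof.
move=> S; pose F b r := foldr (fun i g => iter (b i) (cpartial i) g) f r.
have SF c r : csmooth (F c r) by elim: r => //= k r; exact: csmooth_iter.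
have ne k : i != k -> mi_succ i b k = b k.
  by move=> ik; rewrite /mi_succ eq_sym (negbTE ik) addn0.
suff H r : uniq r -> cpartial i (F b r) =
    if i \in r then F (mi_succ i b) r else cpartial i (F b r).
  by rewrite /mderiv -/(F _ _) H ?enum_uniq // mem_enum.
elim: r => //= j r IHr /andP[jr ur]; rewrite inE.
have [ij|ij] := eqVneq i j.
  rewrite -{}ij in jr *.
  have -> : mi_succ i b i = (b i).+1 by rewrite /mi_succ eqxx addn1.
  rewrite iterS; congr (cpartial _ (iter _ _ _)).
  rewrite /F; elim: r jr {ur IHr} => //= k r IHr; rewrite inE negb_or => /andP[ik kr].
  by rewrite IHr // ne.
rewrite cpartial_iter // orFb; case: ifP => // ir.
by rewrite IHr // ir ne.
Qed.

Lemma mderiv0 f : mderiv (@mi0 d) f = f.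
Proof. by rewrite /mderiv; elim: (enum _). Qed.

End Smooth.

Section Jets.
Context {R : realType}.
Variables (theta : R) (d : nat).
Implicit Types (f : 'rV[R]_d -> R[i]) (D : ('I_d -> nat) -> 'rV[R]_d -> R[i]).

Definition gs_weight (C : R) (a b : 'I_d -> nat) : R :=
  C ^+ (mi_deg a + mi_deg b) * ((mi_fact a * mi_fact b)%:R `^ theta).

(** A certificate that [f] lies in the step of [C] with norm at most [N]. Smoothness of [f] and the
    equality of [D b] with [mderiv b f] are consequences, so a candidate family only needs its
    first-order relations and its bounds checked. *)
Definition gs_jet (C N : R) f D : Prop :=
  [/\ D (@mi0 d) = f,
      forall b i x, is_cderive (D b) x (delta_mx 0 i) (D (mi_succ i b) x) &
      forall a b x, normc ((monom a x)%:C * D b x) <= N * gs_weight C a b].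

Lemma gs_weight_gt0 C a b : 0 < C -> 0 < gs_weight C a b.
Proof.
move=> C0; rewrite mulr_gt0 ?exprn_gt0 // powR_gt0 // ltr0n.
by rewrite muln_gt0 !mi_fact_gt0.
Qed.

Lemma gs_weightV C a b : 0 < C ->
  C ^- (mi_deg a + mi_deg b) * (mi_fact a * mi_fact b)%:R `^ (- theta)
  = (gs_weight C a b)^-1.
Proof. by move=> C0; rewrite powRN invfM. Qed.

Lemma gs_weight_le C C' a b : 0 < C -> C <= C' -> gs_weight C a b <= gs_weight C' a b.
Proof.
move=> C0 CC; rewrite /gs_weight ler_wpM2r ?powR_ge0 //.
by rewrite lerXn2r // nnegrE ?(ltW C0) // (le_trans (ltW C0)).
Qed.

Lemma gs_jet_le C C' N N' f D : 0 < C -> C <= C' -> N <= N' -> 0 <= N ->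
  gs_jet C N f D -> gs_jet C' N' f D.
Proof.
move=> C0 CC NN N0 [D0 Dd Db]; split => // a b x.
apply: le_trans (Db a b x) _.
apply: ler_pM => //; first exact/ltW/gs_weight_gt0.
exact: gs_weight_le.
Qed.

Lemma gs_jet_lin C N N' f g D E (a b : R[i]) : 0 < C ->
  gs_jet C N f D -> gs_jet C N' g E ->
  gs_jet C (normc a * N + normc b * N') (fun x => a * f x + b * g x)
    (fun c x => a * D c x + b * E c x).
Proof.
move=> C0 [D0 Dd Db] [E0 Ed Eb]; split.
- by rewrite D0 E0.
- by move=> c i x; apply: is_cderive_lin.
move=> c e x; rewrite mulrDr [_%:C * (a * _)]mulrCA [_%:C * (b * _)]mulrCA.
apply: le_trans (le_normcD _ _) _; rewrite !(normcM a, normcM b) [leRHS]mulrDl.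
by rewrite -!mulrA; apply: lerD; apply: ler_wpM2l; rewrite ?normc_ge0.
Qed.

Lemma gs_step_jet C N f : 0 < C -> gs_step theta C f ->
  (gs_norm theta C f <= N%:E)%E -> gs_jet C N f (fun b => mderiv b f).
Proof.
move=> C0 [S _] HN; split; first exact: mderiv0.
  move=> b i x; rewrite -cpartial_mderiv //; apply: csmooth_cderive.
  rewrite /mderiv; elim: (enum _) => //= k r; exact: csmooth_iter.
move=> a b x; have W := gs_weight_gt0 a b C0.
rewrite -ler_pdivrMr // mulrC -gs_weightV // -lee_fin.
apply: le_trans HN; apply: ereal_sup_ubound => /=.
by exists a, b, x.
Qed.

Lemma gs_norm_jet C N f D : 0 < C -> gs_jet C N f D ->
  (gs_norm theta C f <= N%:E)%E.
Proof.
move=> C0 [D0 Dd Db].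
have P b i : cpartial i (D b) = D (mi_succ i b).
  by apply: is_cderive_partial => x; exact: Dd.
have M b : mderiv b f = D b.
  rewrite -[in RHS](mi_fold_enum b) /mderiv -D0.
  elim: (enum _) => //= i r ->; set c := foldr _ _ r.
  by elim: (b i) => //= n ->; rewrite P.
apply: ge_ereal_sup => _ [a [b [x ->]]].
rewrite lee_fin gs_weightV // M mulrC ler_pdivrMr ?gs_weight_gt0 //.
Qed.

End Jets.

Lemma coord_le_norm (R : realType) (d : nat) (x : 'rV[R]_d) i : `|x 0 i| <= `|x|.
Proof.
have -> : `|x| = mx_norm x by [].
by rewrite mx_normrE; apply: (le_bigmax _ _ (0, i)).
Qed.

(** Passing from one point to another one coordinate at a time and using the mean value theorem on
    each segment gives a Lipschitz bound. This is why a jet carries no continuity condition. *)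
Lemma partials_bounded_continuous (R : realType) (d : nat) (f : 'rV[R]_d -> R)
    (K : R) (df : 'I_d -> 'rV[R]_d -> R) :
  (forall i x, is_derive x (delta_mx 0 i) f (df i x)) ->
  (forall i x, `|df i x| <= K) -> continuous f.
Proof.
move=> H HK x.
have L i t y : `|f (t *: delta_mx 0 i + y) - f y| <= K * `|t|.
  have [c _] := @MVT_everywhere R _ _ 0 t (is_derive_along y (H i)).
  rewrite subr0 scale0r add0r => ->; rewrite normrM.
  by apply: ler_wpM2r.
have L' y z : `|f y - f z| <= K * \sum_(i < d) `|y 0 i - z 0 i|.
  pose s := index_enum 'I_d.
  have yE : y = \sum_(i <- s) (y 0 i - z 0 i) *: delta_mx 0 i + z.
    rewrite [in LHS](row_sum_delta y) [X in _ + X](row_sum_delta z) -big_split /=.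
    apply: eq_bigr => i _. by rewrite -scalerDl subrK.
  rewrite {1}yE -/s; clear yE.
  elim: s => [|i s IHs]; first by rewrite !big_nil add0r subrr normr0 mulr0.
  rewrite !big_cons -addrA mulrDr.
  set w := _ + z; set p := f (_ + w).
  have -> : p - f z = (p - f w) + (f w - f z) by ring.
  apply: le_trans (ler_normD _ _) _.
  by apply: lerD; [exact: L|exact: IHs].
apply/(@cvgrPdist_le _ _ _ (nbhs x) (nbhs_filter (x : 'rV[R]_d))) => e e0.
have m0 : 0 < (`|K| + 1) * (d%:R + 1) by rewrite mulr_gt0 // ltr_wpDl.
apply/nbhs_ballP; exists (((`|K| + 1) * (d%:R + 1))^-1 * e) => [/=|y].
  by rewrite mulr_gt0 // invr_gt0.
rewrite -ball_normE /= => xy.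
apply: le_trans (L' _ _) _.
have S0 : 0 <= \sum_(i < d) `|x 0 i - y 0 i| by rewrite sumr_ge0.
have Sle : \sum_(i < d) `|x 0 i - y 0 i| <= `|x - y| *+ d.
  apply: (@le_trans _ _ (\sum_(i < d) `|x - y|)); last by rewrite sumr_const card_ord.
  apply: ler_sum => i _.
  by have := coord_le_norm (x - y) i; rewrite !mxE.
apply: (@le_trans _ _ ((`|K| + 1) * ((d%:R + 1) * `|x - y|))).
  apply: (@le_trans _ _ ((`|K| + 1) * \sum_(i < d) `|x 0 i - y 0 i|)).
    by apply: ler_wpM2r => //; rewrite ler_wpDr // ler_norm.
  apply: ler_wpM2l; first by rewrite addr_ge0.
  by apply: le_trans Sle _; rewrite mulrDl mul1r mulr_natl lerDl.
by rewrite mulrA -ler_pdivlMl //; exact: ltW.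
Qed.

Lemma gs_jet_step (R : realType) (theta C N : R) (d : nat) (f : 'rV[R]_d -> R[i]) D :
  0 < C -> gs_jet theta C N f D -> gs_step theta C f.
Proof.
move=> C0 J; split; last first.
  by apply: le_lt_trans (gs_norm_jet C0 J) _; exact: ltry.
have [D0 Dd Db] := J.
have P b i : cpartial i (D b) = D (mi_succ i b).
  by apply: is_cderive_partial => x; exact: Dd.
have cE s : foldr (@cpartial R d) f s = D (foldr (@mi_succ d) (@mi0 d) s).
  by elim: s => //= i s ->; rewrite P.
(* Summing over the directions gives one bound for all partial derivatives of [D b]; [|N|] appears
   because no sign is assumed for [N]. The bound itself is the jet estimate with trivial
   monomial. *)
pose K b := \sum_(i < d) `|N| * gs_weight theta C (@mi0 d) (mi_succ i b).
have HK b i x : normc (D (mi_succ i b) x) <= K b.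
  have := Db (@mi0 d) (mi_succ i b) x.
  rewrite /monom big1 => [|j _]; last by rewrite expr0.
  rewrite mul1r => /le_trans; apply.
  rewrite /K (bigD1 i) //= ler_wpDr //.
    by apply: sumr_ge0 => j _; rewrite mulr_ge0 // ltW // gs_weight_gt0.
  by apply: ler_wpM2r; [rewrite ltW // gs_weight_gt0|exact: ler_norm].
move=> s g; rewrite /g cE; set b := foldr _ _ s; split.
- apply: (@partials_bounded_continuous _ _ _ (K b)
    (fun i x => complex.Re (D (mi_succ i b) x))) => i x.
    by have [] := Dd b i x.
  exact: le_trans (normRe_le _) (HK _ _ _).
- apply: (@partials_bounded_continuous _ _ _ (K b)
    (fun i x => complex.Im (D (mi_succ i b) x))) => i x.
    by have [] := Dd b i x.
  exact: le_trans (normIm_le _) (HK _ _ _).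
by move=> i x; have [[? _] [? _]] := Dd b i x.
Qed.

Lemma gs_spaceP (R : realType) (theta : R) (d : nat) (f : 'rV[R]_d -> R[i]) :
  gs_space theta f <-> exists C N D, [/\ 0 < C, 0 < N & gs_jet theta C N f D].
Proof.
split=> [[C C0 Sf]|[C [N [D [C0 _ J]]]]]; last first.
  by exists C => //; exact: gs_jet_step J.
have : exists2 N : R, 0 < N & (gs_norm theta C f <= N%:E)%E.
  case: (Sf) => _; case: (gs_norm theta C f) => [r|//|] _.
    by exists (`|r| + 1); rewrite ?ltr_wpDl // lee_fin ler_wpDr // ler_norm.
  by exists 1 => //; rewrite leNye.
case=> N N0 HN; exists C, N, (fun b => mderiv b f); split => //.
exact: gs_step_jet.
Qed.

(** * Continuity of functionals *)

Section Dual.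
Context {R : realType}.
Variables (theta : R) (d : nat).
Implicit Types (u : ('rV[R]_d -> R[i]) -> R[i]) (f : 'rV[R]_d -> R[i]).

Definition gs_linear u : Prop := forall f g (a b : R[i]),
  gs_space theta f -> gs_space theta g ->
  u (fun x => a * f x + b * g x) = a * u f + b * u g.

Definition gs_bounded u : Prop := forall C : R, 0 < C ->
  exists2 M : R, 0 < M & forall N f D, 0 < N -> gs_jet theta C N f D ->
    normc (u f) <= M * N.

Lemma gs_space_jet C N f D : 0 < C -> 0 < N -> gs_jet theta C N f D -> gs_space theta f.
Proof. by move=> C0 N0 J; apply/gs_spaceP; exists C, N, D. Qed.

Lemma gs_space_lin f g (a b : R[i]) : gs_space theta f -> gs_space theta g ->
  gs_space theta (fun x => a * f x + b * g x).
Proof.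
move=> /gs_spaceP[C [N [D [C0 N0 Jf]]]] /gs_spaceP[C' [N' [E [C'0 N'0 Jg]]]].
have M0 : 0 < Num.max C C' by rewrite lt_max C0.
exists (Num.max C C') => //; apply: (gs_jet_step M0).
by apply: gs_jet_lin => //;
  [apply: (gs_jet_le C0 _ (lexx N) (ltW N0) Jf)|apply: (gs_jet_le C'0 _ (lexx N') (ltW N'0) Jg)];
  rewrite le_max lexx ?orbT.
Qed.

Lemma gs_space0 : gs_space theta (fun _ : 'rV[R]_d => 0 : R[i]).
Proof.
apply/gs_spaceP; exists 1, 1, (fun _ _ => 0); split => //; split => //.
  by move=> b i x; exact: is_cderive_cst_along.
by move=> a b x; rewrite mulr0 normc0 mul1r ltW // gs_weight_gt0.
Qed.

Lemma gs_linearZ u f (a : R[i]) : gs_linear u -> gs_space theta f ->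
  u (fun x => a * f x) = a * u f.
Proof.
move=> L S; have := L f f a 0 S S; rewrite mul0r addr0 => <-; congr u.
by apply/funext => x; rewrite mul0r addr0.
Qed.

Lemma gs_linear0 u : gs_linear u -> u (fun _ => 0) = 0.
Proof.
move=> L; rewrite -[RHS](mul0r (u (fun _ => 0))) -(gs_linearZ 0 L gs_space0).
congr u.
by apply/funext => x; rewrite mul0r.
Qed.

(** A basic neighbourhood contains a ball of each step, so continuity at 0 and scaling bound [u]
    there. Conversely, a bound on each step makes the set where |u g| < e a basic neighbourhood:
    linearity gives absolute convexity and translates it to any base point. *)
Lemma gs_dualP u : gs_dual theta u <-> gs_linear u /\ gs_bounded u.
Proof.
split=> [[L K]|[L B]]; split => //.
  move=> C C0; have [V [Vs Va /(_ C C0)[r r0 HV]] HA] := K _ gs_space0 1 ltr01.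
  exists (2 / r) => [|N f D N0 J]; first by rewrite divr_gt0.
  (* The scaling brings the jet bound [N] to [r / 2] and not to [r], because the ball is given by a
     strict inequality while jets only give a weak one. *)
  pose s := r / (2 * N); have s0 : 0 < s by rewrite divr_gt0 // mulr_gt0.
  have Js : gs_jet theta C (r / 2) (fun x => s%:C * f x + 0 * f x)
      (fun c x => s%:C * D c x + 0 * D c x).
    have := gs_jet_lin (s%:C) 0 C0 J J; rewrite normc0 mul0r addr0 normc_real.
    rewrite gtr0_norm //; congr (gs_jet _ _ _ _ _); rewrite /s; field.
    by rewrite gt_eqF.
  have : V (fun x => s%:C * f x + 0 * f x).
    apply: HV; first exact: gs_jet_step Js.
    apply: le_lt_trans (gs_norm_jet C0 Js) _; rewrite lte_fin.
    by rewrite ltr_pdivrMr // mulr_natr mulr2n ltrDr.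
  move=> /HA /=; rewrite gs_linear0 // subr0.
  under eq_fun => x do rewrite add0r mul0r addr0.
  rewrite gs_linearZ //; last exact: gs_space_jet J.
  rewrite normcM normc_real gtr0_norm // -ltr_pdivlMl // mulr1 => /ltW H.
  by apply: le_trans H _; rewrite /s invf_div mulrAC.
move=> f Sf e e0.
exists [set g | gs_space theta g /\ normc (u g) < e]; last first.
  move=> g [Sg ge] /=.
  have -> : (fun x => f x + g x) = (fun x => 1 * f x + 1 * g x).
    by apply/funext => x; rewrite !mul1r.
  by rewrite L // !mul1r addrAC subrr add0r.
split => [g [] //|g h a b [Sg ge] [Sh he] ab|C C0].
  split; first exact: gs_space_lin.
  rewrite L //; apply: le_lt_trans (le_normcD _ _) _; rewrite !normcM.
  pose m := Num.max (normc (u g)) (normc (u h)).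
  apply: (@le_lt_trans _ _ m); last by rewrite gt_max ge.
  apply: (@le_trans _ _ ((normc a + normc b) * m)).
    by rewrite mulrDl; apply: lerD; apply: ler_wpM2l; rewrite ?normc_ge0 // le_max lexx ?orbT.
  by rewrite -[leRHS]mul1r ler_wpM2r // le_max normc_ge0.
have [M M0 HM] := B C C0; exists (e / (2 * M)); first by rewrite divr_gt0 // mulr_gt0.
move=> f' Sf' Hf'.
have J := gs_step_jet C0 Sf' (ltW Hf').
split; first by exists C.
have E0 : 0 < e / (2 * M) by rewrite divr_gt0 // mulr_gt0.
apply: le_lt_trans (HM _ _ _ E0 J) _.
have -> : M * (e / (2 * M)) = e / 2 by field; rewrite gt_eqF.
by rewrite ltr_pdivrMr // mulr_natr mulr2n ltrDr.
Qed.

End Dual.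

(** * Tensor products *)

Lemma is_cderive_reparam (R : realType) (V W : normedModType R)
    (f : V -> R[i]) (g : W -> R[i]) (x v : V) (y w : W) df :
  (forall h : R, g (h *: w + y) = f (h *: v + x)) ->
  is_cderive f x v df -> is_cderive g y w df.
Proof.
move=> E [/is_derive_line H1 /is_derive_line H2]; split; apply/is_derive_line.
  by under [X in is_derive _ _ X]eq_fun => h do rewrite E.
by under [X in is_derive _ _ X]eq_fun => h do rewrite E.
Qed.

(** The mean value theorem fails for complex values, so real and imaginary parts are estimated
    separately, at the cost of a factor 2. *)
Lemma cquotient_remainder (R : realType) (V : normedModType R)
    (f df ddf : V -> R[i]) (x v : V) (B h : R) :
  (forall y, is_cderive f y v (df y)) -> (forall y, is_cderive df y v (ddf y)) ->
  (forall t : R, normc (ddf (t *: v + x)) <= B) -> h != 0 ->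
  normc ((h^-1)%:C * (f (h *: v + x) - f x) - df x) <= 2 * B * `|h|.
Proof.
move=> H1 H2 HB h0; apply: le_trans (normc_le_ReIm _) _.
have P1 := is_cderive_along x H1; have P2 := is_cderive_along x H2.
rewrite mulrAC mulr2n mulrDl mul1r mulrDl [_ * B]mulrC; apply: lerD.
  have := quotient_remainder (fun t => (P1 t).1) (fun t => (P2 t).1)
    (fun t => le_trans (normRe_le _) (HB _)) h0.
  rewrite scale0r add0r complex_ReD complex_ReN complex_ReM complex_ReD complex_ReN.
  by rewrite /= mul0r subr0.
have := quotient_remainder (fun t => (P1 t).2) (fun t => (P2 t).2)
  (fun t => le_trans (normIm_le _) (HB _)) h0.
by rewrite scale0r add0r complex_ImD complex_ImN complex_ImM complex_ImD complex_ImN /= mul0r addr0.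
Qed.

Section Concatenation.
Context {R : realType}.
Variables (d1 d2 : nat).

Definition mi_cat (b1 : 'I_d1 -> nat) (b2 : 'I_d2 -> nat) : 'I_(d1 + d2) -> nat := fun k =>
  match fintype.split k with inl i => b1 i | inr j => b2 j end.

Lemma mi_cat_l b1 b2 i : mi_cat b1 b2 (lshift d2 i) = b1 i.
Proof. by rewrite /mi_cat (unsplitK (inl i)). Qed.

Lemma mi_cat_r b1 b2 j : mi_cat b1 b2 (rshift d1 j) = b2 j.
Proof. by rewrite /mi_cat (unsplitK (inr j)). Qed.

Lemma mi_cat_succl i b1 b2 :
  mi_cat (mi_succ i b1) b2 = mi_succ (lshift d2 i) (mi_cat b1 b2).
Proof.
apply/funext => k; case: (split_ordP k) => j ->; rewrite /mi_succ !(mi_cat_l, mi_cat_r).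
  by rewrite eq_lshift.
by rewrite eq_rlshift addn0.
Qed.

Lemma mi_cat_succr j b1 b2 :
  mi_cat b1 (mi_succ j b2) = mi_succ (rshift d1 j) (mi_cat b1 b2).
Proof.
apply/funext => k; case: (split_ordP k) => i ->; rewrite /mi_succ !(mi_cat_l, mi_cat_r).
  by rewrite eq_lrshift addn0.
by rewrite eq_rshift.
Qed.

Lemma mi_cat0 : mi_cat (@mi0 d1) (@mi0 d2) = @mi0 (d1 + d2).
Proof.
by apply/funext => k; case: (split_ordP k) => i ->; rewrite ?mi_cat_l ?mi_cat_r.
Qed.

Lemma mi_deg_cat b1 b2 : mi_deg (mi_cat b1 b2) = (mi_deg b1 + mi_deg b2)%N.
Proof.
rewrite /mi_deg big_split_ord /=; congr addn; apply: eq_bigr => i _;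
  by rewrite ?mi_cat_l ?mi_cat_r.
Qed.

Lemma mi_fact_cat b1 b2 : mi_fact (mi_cat b1 b2) = (mi_fact b1 * mi_fact b2)%N.
Proof.
rewrite /mi_fact big_split_ord /=; congr muln; apply: eq_bigr => i _;
  by rewrite ?mi_cat_l ?mi_cat_r.
Qed.

Lemma monom_cat b1 b2 (x : 'rV[R]_d1) (y : 'rV[R]_d2) :
  monom (mi_cat b1 b2) (row_mx x y) = monom b1 x * monom b2 y.
Proof.
rewrite /monom big_split_ord /=; congr (_ * _); apply: eq_bigr => i _.
  by rewrite mi_cat_l row_mxEl.
by rewrite mi_cat_r row_mxEr.
Qed.

(** Degrees add and factorials multiply under concatenation. The splitting is exact, with the same
    [C] in both factors, and this keeps the partial pairing in the step of [f]. *)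
Lemma gs_weight_cat (theta C : R) a1 a2 b1 b2 :
  gs_weight theta C (mi_cat a1 a2) (mi_cat b1 b2) =
  gs_weight theta C a1 b1 * gs_weight theta C a2 b2.
Proof.
rewrite /gs_weight !mi_deg_cat !mi_fact_cat addnACA exprD mulrACA -powRM //.
by congr (_ * (_ `^ _)); rewrite -natrM mulnACA.
Qed.

Lemma delta_lshift (i : 'I_d1) (h : R) (x : 'rV[R]_d1) (y : 'rV[R]_d2) :
  row_mx (h *: delta_mx 0 i + x) y = h *: delta_mx 0 (lshift d2 i) + row_mx x y.
Proof.
apply/rowP => k; case: (split_ordP k) => j ->.
  by rewrite row_mxEl [RHS]mxE row_mxEl !mxE eq_lshift.
by rewrite row_mxEr [RHS]mxE row_mxEr !mxE eq_rlshift andbF mulr0 add0r.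
Qed.

Lemma delta_rshift (j : 'I_d2) (h : R) (x : 'rV[R]_d1) (y : 'rV[R]_d2) :
  row_mx x (h *: delta_mx 0 j + y) = h *: delta_mx 0 (rshift d1 j) + row_mx x y.
Proof.
apply/rowP => k; case: (split_ordP k) => i ->.
  by rewrite row_mxEl [RHS]mxE row_mxEl !mxE eq_lrshift andbF mulr0 add0r.
by rewrite row_mxEr [RHS]mxE row_mxEr !mxE eq_rshift.
Qed.

End Concatenation.

(** * Pairing in the second group of variables *)

Section PartialPairing.
Context {R : realType}.
Variables (theta C N : R) (d1 d2 : nat).
Variables (f : 'rV[R]_(d1 + d2) -> R[i]) (D : ('I_(d1 + d2) -> nat) -> 'rV[R]_(d1 + d2) -> R[i]).
Hypotheses (C0 : 0 < C) (N0 : 0 < N) (J : gs_jet theta C N f D).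
Local Notation w := (gs_weight theta C).

Lemma slice_bound (a1 b1 : 'I_d1 -> nat) (a2 b2 : 'I_d2 -> nat)
    (x : 'rV[R]_d1) (y : 'rV[R]_d2) :
  normc ((monom a2 y)%:C * ((monom a1 x)%:C * D (mi_cat b1 b2) (row_mx x y)))
  <= N * w a1 b1 * w a2 b2.
Proof.
have [_ _ Db] := J.
rewrite mulrA -rmorphM [monom a2 y * _]mulrC -monom_cat -mulrA -gs_weight_cat.
exact: Db.
Qed.

Lemma slice_cderive (b1 : 'I_d1 -> nat) (b2 : 'I_d2 -> nat) (x : 'rV[R]_d1) y j :
  is_cderive (fun y => D (mi_cat b1 b2) (row_mx x y)) y (delta_mx 0 j)
    (D (mi_cat b1 (mi_succ j b2)) (row_mx x y)).
Proof.
have [_ Dd _] := J.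
apply: (is_cderive_reparam (fun h => congr1 (D (mi_cat b1 b2)) (delta_rshift j h x y))).
by rewrite mi_cat_succr; exact: Dd.
Qed.

(** The weight in the first variable becomes part of the jet bound of the slice; a functional
    bounded on the step hands it back as the estimate required in that variable. *)
Lemma slice_jet (a1 b1 : 'I_d1 -> nat) (x : 'rV[R]_d1) :
  gs_jet theta C (N * w a1 b1)
    (fun y => (monom a1 x)%:C * D (mi_cat b1 (@mi0 d2)) (row_mx x y))
    (fun b2 y => (monom a1 x)%:C * D (mi_cat b1 b2) (row_mx x y)).
Proof.
split => // [b i y|a b y]; last exact: slice_bound.
by apply: is_cderiveZ; exact: slice_cderive.
Qed.

Lemma slice_space (b1 : 'I_d1 -> nat) (x : 'rV[R]_d1) :
  gs_space theta (fun y => D (mi_cat b1 (@mi0 d2)) (row_mx x y)).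
Proof.
have := slice_jet (@mi0 d1) b1 x; rewrite /monom big1 => [H|i _]; last by rewrite expr0.
apply: (gs_space_jet C0 _ (D := fun b2 y => D (mi_cat b1 b2) (row_mx x y))); last first.
  case: H => H1 H2 H3; split => //.
  - by move=> b i y; exact: slice_cderive.
  - by move=> a b y; have := H3 a b y; rewrite rmorph1 mul1r; apply.
by rewrite mulr_gt0 // gs_weight_gt0.
Qed.

(** Difference quotients in the first variable converge in the step norm of the second one, at a
    linear rate. The coefficients 1 and -1 are written out to match the form of [gs_linear]. *)
Lemma quotient_jet (b1 : 'I_d1 -> nat) (x : 'rV[R]_d1) (i : 'I_d1) (h : R) : h != 0 ->
  gs_jet theta C (2 * `|h| * (N * w (@mi0 d1) (mi_succ i (mi_succ i b1))))
    (fun y => (h^-1)%:C * (1 * D (mi_cat b1 (@mi0 d2)) (row_mx (h *: delta_mx 0 i + x) y)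
       + (-1) * D (mi_cat b1 (@mi0 d2)) (row_mx x y))
       + (-1) * D (mi_cat (mi_succ i b1) (@mi0 d2)) (row_mx x y))
    (fun b2 y => (h^-1)%:C * (1 * D (mi_cat b1 b2) (row_mx (h *: delta_mx 0 i + x) y)
       + (-1) * D (mi_cat b1 b2) (row_mx x y))
       + (-1) * D (mi_cat (mi_succ i b1) b2) (row_mx x y)).
Proof.
move=> h0; split => // [b j y|a b y].
  apply: is_cderiveD; last by apply: is_cderiveZ; exact: slice_cderive.
  by apply/is_cderiveZ/is_cderive_lin; exact: slice_cderive.
have [_ Dd Db] := J.
(* The monomial is frozen at [y] and hence constant along direction [k], so the mean value estimate
   can be applied to the weighted function directly. *)
pose F c z := (monom a y)%:C * D c z.
have Fd c k z : is_cderive (F c) z (delta_mx 0 k) (F (mi_succ k c) z).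
  exact: is_cderiveZ.
pose c := mi_cat b1 b; pose k := lshift d2 i.
have B t : normc (F (mi_succ k (mi_succ k c)) (t *: delta_mx 0 k + row_mx x y))
    <= N * w (@mi0 d1) (mi_succ i (mi_succ i b1)) * w a b.
  rewrite -delta_lshift -!mi_cat_succl.
  have := slice_bound (@mi0 d1) (mi_succ i (mi_succ i b1)) a b (t *: delta_mx 0 i + x) y.
  by rewrite [X in X%:C * D _ _]/monom big1 ?mul1r // => j _; rewrite expr0.
have := cquotient_remainder (Fd c k) (Fd (mi_succ k c) k) B h0.
rewrite -delta_lshift /F /k -mi_cat_succl -/c.
rewrite [2 * _ * _ in leRHS]mulrAC mulrA; congr (normc _ <= _); ring.
Qed.

Variables (v : ('rV[R]_d2 -> R[i]) -> R[i]) (M : R).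
Hypothesis (vlin : gs_linear theta v).
Hypothesis (vM : forall N' g E, 0 < N' -> gs_jet theta C N' g E -> normc (v g) <= M * N').

(** Boundedness of [v] on the step of [C] turns the rate of [quotient_jet] into differentiability.
    For the bounds, linearity moves the monomial in [x] under [v], where [slice_jet] applies. *)
Lemma pairing_jet : gs_jet theta C (M * N) (fun x => v (fun y => f (row_mx x y)))
  (fun b1 x => v (fun y => D (mi_cat b1 (@mi0 d2)) (row_mx x y))).
Proof.
have [D0 Dd Db] := J; split.
- by rewrite mi_cat0 D0.
- move=> b1 i x; set K := N * w (@mi0 d1) (mi_succ i (mi_succ i b1)).
  have K0 : 0 < K by rewrite mulr_gt0 // gs_weight_gt0.
  apply: (@is_cderive_of_quotient _ _ _ _ _ _ (M * (2 * K))) => h h0.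
  have h0' : 0 < 2 * `|h| * K by rewrite mulr_gt0 // mulr_gt0 // normr_gt0.
  have := vM h0' (quotient_jet b1 x i h0).
  have S b z := slice_space b z.
  have SS := gs_space_lin 1 (-1) (S b1 (h *: delta_mx 0 i + x)) (S b1 x).
  rewrite (@vlin (fun y => _) (fun y => D _ (row_mx x y)) _ _ SS (S _ _)).
  rewrite (@vlin _ _ _ _ (S _ _) (S _ _)).
  by rewrite !mul1r !mulN1r [2 * _ * _]mulrAC [M * (2 * K * _)]mulrA.
move=> a1 b1 x; rewrite -(gs_linearZ _ vlin (slice_space b1 x)).
rewrite -mulrA; apply: vM (slice_jet a1 b1 x).
by rewrite mulr_gt0 // gs_weight_gt0.
Qed.

End PartialPairing.

Lemma gs_dual_tensor (R : realType) (theta : R) (d1 d2 : nat)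
    (u : ('rV[R]_d1 -> R[i]) -> R[i]) (v : ('rV[R]_d2 -> R[i]) -> R[i]) :
  gs_dual theta u -> gs_dual theta v -> gs_dual theta (tensor u v).
Proof.
move=> /gs_dualP[ul ub] /gs_dualP[vl vb].
have slices f : gs_space theta f ->
    (forall x, gs_space theta (fun y : 'rV[R]_d2 => f (row_mx x y))) /\
    gs_space theta (fun x : 'rV[R]_d1 => v (fun y => f (row_mx x y))).
  move=> /gs_spaceP[C [N [D [C0 N0 J]]]]; split=> [x|].
    have := slice_space C0 N0 J (@mi0 d1) x.
    by rewrite mi_cat0; case: J => ->.
  have [M M0 HM] := vb C C0.
  by apply: (gs_space_jet C0 _ (pairing_jet C0 N0 J vl HM)); rewrite mulr_gt0.
apply/gs_dualP; split=> [f g a b Sf Sg|C C0].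
  have [fx Sfx] := slices _ Sf; have [gx Sgx] := slices _ Sg.
  rewrite /tensor -ul //; congr u; apply/funext => x; exact: vl.
have [M M0 HM] := vb C C0; have [L L0 HL] := ub C C0.
exists (L * M) => [|N f D N0 J]; first by rewrite mulr_gt0.
rewrite -mulrA; apply: HL (pairing_jet C0 N0 J vl HM).
by rewrite mulr_gt0.
Qed.

(** * Hermite recursion for one-dimensional wave packets *)

Section Packet1.
Context {R : realType}.
Variables (p q : R).

Definition packet_arg (t : R) : R[i] := (t - p) +i* q.

(** The derivatives of the one-dimensional packet phi. Since phi' = -(t - p + i q) phi, Leibniz'
    rule gives this three-term recursion: up to sign, phi times the Hermite polynomials at the
    complex point t - p + i q. *)
Fixpoint packet1 (n : nat) (t : R) : R[i] :=
  match n with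
  | 0%N => (expR (- ((t - p) ^+ 2 / 2)))%:C * (cos (t * q) -i* sin (t * q))
  | n'.+1 => - packet_arg t * packet1 n' t
             - match n' with 0%N => 0 | m.+1 => n'%:R * packet1 m t end
  end.

(** For [n = 0] the truncated predecessor is harmless, as its coefficient vanishes; this removes the
    case distinction from the recursion. *)
Lemma packet1S n t :
  packet1 n.+1 t = - packet_arg t * packet1 n t - n%:R * packet1 n.-1 t.
Proof. by case: n => [|n] //=; rewrite mul0r. Qed.

Lemma packet1_cderive0 (t : R) : is_cderive (packet1 0) t 1 (packet1 1 t).
Proof.
have dsq : is_derive t (1 : R) (fun s : R => - ((s - p) ^+ 2 / 2)) (- (t - p)).
  have dm : is_derive t (1 : R) (fun s : R => s - p) (1 - 0) by apply: is_deriveB.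
  have := is_deriveN (is_deriveM (is_deriveM dm dm) (is_derive_cst (2^-1 : R) t 1)).
  have -> : - ((fun s : R => s - p) * (fun s : R => s - p) * cst (2^-1 : R)) =
    (fun s : R => - ((s - p) ^+ 2 / 2)) by apply/funext => s; rewrite expr2.
  by move=> H; apply: (is_derive_eq H); rewrite /GRing.scale /=; field.
have dl : is_derive t (1 : R) (fun s : R => s * q) q.
  have := is_deriveM (is_derive_id t (1 : R)) (is_derive_cst q t (1 : R)).
  by move=> H; apply: (is_derive_eq H); rewrite /GRing.scale /= mulr0 add0r mulr1.
have dE := is_derive1_comp (is_derive_expR _) dsq.
have dc := is_derive1_comp (is_derive_cos _) dl.
have ds := is_derive1_comp (is_derive_sin _) dl.
rewrite packet1S mul0r subr0.
apply: (is_cderive_reparam (f := packet1 0) (fun _ => erefl)).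
have -> : - packet_arg t * packet1 0 t =
   (expR (- ((t - p) ^+ 2 / 2)) * - (t - p))%:C * (cos (t * q) -i* sin (t * q))
   + (expR (- ((t - p) ^+ 2 / 2)))%:C *
     ((- sin (t * q) * q) +i* (- (cos (t * q) * q))).
  apply/eqP; rewrite eq_complex /= !(mul0r, subr0, addr0, oppr0).
  by apply/andP; split; apply/eqP; ring.
apply: is_cderiveM; split => /=.
- exact: dE.
- exact: is_derive_cst.
- exact: dc.
- exact: (is_deriveN ds).
Qed.

Lemma packet_arg_cderive (t : R) : is_cderive packet_arg t 1 1.
Proof.
split => /=; last exact: is_derive_cst.
have := is_deriveB (is_derive_id t (1 : R)) (is_derive_cst p t (1 : R)).
by move=> H; apply: (is_derive_eq H); rewrite subr0.
Qed.

Lemma packet1_cderive n (t : R) : is_cderive (packet1 n) t 1 (packet1 n.+1 t).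
Proof.
(* The recursion reaches back two indices, so the induction carries two consecutive derivatives. *)
suff : (forall t : R, is_cderive (packet1 n) t 1 (packet1 n.+1 t)) /\
    (forall t : R, is_cderive (packet1 n.+1) t 1 (packet1 n.+2 t)) by case.
have step m : (forall t : R, is_cderive (packet1 m) t 1 (packet1 m.+1 t)) ->
    (forall t : R, is_cderive (fun s => m%:R * packet1 m.-1 s) t 1 (m%:R * packet1 m t)) ->
    forall t : R, is_cderive (packet1 m.+1) t 1 (packet1 m.+2 t).
  move=> H1 H2 s.
  have -> : packet1 m.+1 = fun s => -1 * (packet_arg s * packet1 m s)
      + -1 * (m%:R * packet1 m.-1 s).
    by apply/funext => s'; rewrite packet1S; ring.
  have -> : packet1 m.+2 s = -1 * (1 * packet1 m s + packet_arg s * packet1 m.+1 s)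
      + -1 * (m%:R * packet1 m s).
    by rewrite (packet1S m.+1) -natr1 /=; ring.
  apply: is_cderive_lin => //; apply: is_cderiveM => //; exact: packet_arg_cderive.
elim: n => [|n [IH1 IH2]].
  split; first exact: packet1_cderive0.
  apply: step => s; first exact: packet1_cderive0.
  by rewrite mul0r; apply: is_cderive_cst_along => h; rewrite !mul0r.
by split => //; apply: step => // s; apply: is_cderiveZ.
Qed.

Lemma normc_cis (t : R) : normc (cos t -i* sin t) = 1.
Proof. by rewrite /normc sqrrN cos2Dsin2 sqrtr1. Qed.

(* The Hermite recursion turns into [r (r + s)^n + n (r + s)^(n-1) <= (r + s)^(n+1)]
   with [s^2 = n]. *)
Lemma packet1_bound n (t : R) :
  normc (packet1 n t) <=
  (`|t - p| + `|q| + Num.sqrt n%:R) ^+ n * expR (- ((t - p) ^+ 2 / 2)).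
Proof.
set r := `|t - p| + `|q|; set e := expR _.
have r0 : 0 <= r by rewrite addr_ge0.
have e0 : 0 <= e by exact: expR_ge0.
have wr : normc (packet_arg t) <= r by exact: normc_le_ReIm.
have N0 : normc (packet1 0 t) = e.
  by rewrite [packet1 0 t]/= normcM normc_cis mulr1 normc_real gtr0_norm ?expR_gt0.
have sq m : 0 <= Num.sqrt m%:R :> R by exact: sqrtr_ge0.
have key m : r * (r + Num.sqrt m%:R) ^+ m + m%:R * (r + Num.sqrt m.-1%:R) ^+ m.-1
     <= (r + Num.sqrt m.+1%:R) ^+ m.+1.
  apply: (@le_trans _ _ ((r + Num.sqrt m%:R) ^+ m.+1)); last first.
    rewrite lerXn2r ?nnegrE ?addr_ge0 //; apply: lerD => //.
    by rewrite ler_wsqrtr // ler_nat.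
  case: m => [|m]; first by rewrite sqrtr0 mul0r !expr0 expr1 mulr1 !addr0.
  set s := Num.sqrt m.+1%:R; have s2 : m.+1%:R = s ^+ 2 by rewrite sqr_sqrtr // ler0n.
  rewrite s2 /=; have s0 : 0 <= s by exact: sq.
  apply: (@le_trans _ _ (r * (r + s) ^+ m.+1 + s ^+ 2 * (r + s) ^+ m)).
    rewrite lerD2l ler_wpM2l ?sqr_ge0 // lerXn2r ?nnegrE ?addr_ge0 //.
    by rewrite lerD2l ler_wsqrtr // ler_nat.
  rewrite !exprS !mulrA -mulrDl; apply: ler_wpM2r; first by rewrite exprn_ge0 // addr_ge0.
  nra.
have step m : normc (packet1 m t) <= (r + Num.sqrt m%:R) ^+ m * e ->
    normc (packet1 m.-1 t) <= (r + Num.sqrt m.-1%:R) ^+ m.-1 * e ->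
    normc (packet1 m.+1 t) <= (r + Num.sqrt m.+1%:R) ^+ m.+1 * e.
  move=> H1 H2; rewrite packet1S; apply: le_trans (normcB _ _) _.
  rewrite !normcM normcN.
  have -> : m%:R = (m%:R)%:C :> R[i] by rewrite rmorph_nat.
  rewrite normc_real normr_nat.
  apply: le_trans (_ : _ <= (r * (r + Num.sqrt m%:R) ^+ m +
    m%:R * (r + Num.sqrt m.-1%:R) ^+ m.-1) * e) _.
    rewrite mulrDl -!mulrA; apply: lerD; first by apply: ler_pM; rewrite ?normc_ge0.
    by apply: ler_wpM2l.
  by apply: ler_wpM2r.
suff : normc (packet1 n t) <= (r + Num.sqrt n%:R) ^+ n * e /\
    normc (packet1 n.+1 t) <= (r + Num.sqrt n.+1%:R) ^+ n.+1 * e by case.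
have B0 : normc (packet1 0 t) <= (r + Num.sqrt 0%:R) ^+ 0 * e by rewrite N0 expr0 mul1r.
elim: n => [|n [IH1 IH2]]; last by split => //; apply: step.
by split => //; apply: step.
Qed.

End Packet1.

(** * Powers against factorials and exponentials *)

Section PowerBounds.
Context {R : realType}.

(** With x = (h r)^(1/theta), the exponential series gives x^n <= n! e^x, and raising this to the
    power theta yields the claim. The parameter [h] trades the geometric rate against the size of
    the exponent. *)
Lemma pow_le_fact_exp (theta h r : R) (n : nat) : 0 < theta -> 0 < h -> 0 <= r ->
  r ^+ n <= h^-1 ^+ n * (n`!%:R `^ theta * expR (theta * (h * r) `^ theta^-1)).
Proof.
move=> t0 h0 r0; set x := (h * r) `^ theta^-1.
have hr0 : 0 <= h * r by rewrite mulr_ge0 // ltW.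
have x0 : 0 <= x by exact: powR_ge0.
have f0 : 0 < n`!%:R :> R by rewrite ltr0n fact_gt0.
have H : x ^+ n <= n`!%:R * expR x.
  rewrite -ler_pdivrMl // mulrC; case: n f0 => [_|n _].
    by rewrite expr0 fact0 divr1 -expR0 ler_expR.
  by apply: le_trans (expR_ge1Dxn n x0); rewrite lerDr.
have xE : (x ^+ n) `^ theta = (h * r) ^+ n.
  rewrite -powR_mulrn // -powRrM mulrC powRrM /x -(powRrM (h * r)) mulVf ?gt_eqF //.
  by rewrite powRr1 // powR_mulrn.
have := ge0_ler_powR (ltW t0) _ _ H; rewrite !nnegrE exprn_ge0 // => /(_ isT).
rewrite mulr_ge0 ?expR_ge0 ?(ltW f0) // => /(_ isT).
rewrite powRM ?expR_ge0 ?(ltW f0) // -expRM [_ * theta]mulrC xE.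
by rewrite exprMn => K; rewrite exprVn ler_pdivlMl // exprn_gt0.
Qed.

Lemma pow_le_sqrt_fact_exp (h r : R) (n : nat) : 0 < h -> 0 <= r ->
  r ^+ n <= h^-1 ^+ n * (n`!%:R `^ 2^-1 * expR ((h * r) ^+ 2 / 2)).
Proof.
move=> h0 r0; have i0 : 0 < 2^-1 :> R by rewrite invr_gt0.
have := pow_le_fact_exp n i0 h0 r0; rewrite invrK [_ `^ 2]powR_mulrn.
  by rewrite [2^-1 * _]mulrC.
by rewrite mulr_ge0 // ltW.
Qed.

Lemma exprD_le (x y : R) n : 0 <= x -> 0 <= y -> (x + y) ^+ n <= 2 ^+ n * (x ^+ n + y ^+ n).
Proof.
move=> x0 y0; wlog xy : x y x0 y0 / x <= y => [W|].
  have [xy|/ltW yx] := leP x y; first exact: W.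
  by rewrite addrC [x ^+ n + _]addrC; exact: W.
apply: (@le_trans _ _ ((2 * y) ^+ n)).
  by rewrite lerXn2r ?nnegrE ?addr_ge0 ?mulr_ge0 // mulrDl mul1r lerD2r.
by rewrite exprMn ler_wpM2l ?exprn_ge0 // lerDr exprn_ge0.
Qed.

Lemma ge1_add_le (x y : R) : 1 <= x -> 1 <= y ->
  x + y <= 2 * (x * y) /\ x + y + 1 <= 3 * (x * y).
Proof. by move=> x1 y1; split; nra. Qed.

End PowerBounds.

Section Packet1Weight.
Context {R : realType}.
Variables (theta h : R).
Hypotheses (theta_ge : 2^-1 <= theta) (h0 : 0 < h).

Let A : R := expR (2^-1).
(** The sum dominates the three geometric rates that occur: [2] for powers of t - p, [h^-1] for
    powers of the centre and the frequency, and [A] for the square root of n in [packet1_bound]. *)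
Definition packet_base : R := 2 + h^-1 + A.
Local Notation B := packet_base.
Local Notation E r := (expR (theta * (h * `|r|) `^ theta^-1)).

Let t0 : 0 < theta. Proof. by apply: lt_le_trans theta_ge; rewrite invr_gt0. Qed.
Let A0 : 0 < A. Proof. exact: expR_gt0. Qed.
Let i0 : 0 < h^-1. Proof. by rewrite invr_gt0. Qed.

Lemma packet_base_gt0 : 0 < B.
Proof. by rewrite /B !addr_gt0. Qed.

(** Gaussian and Hermite estimates produce factorials to the power 1/2; the lower bound on [theta]
    absorbs them into the weight. *)
Let fact_le n : n`!%:R `^ 2^-1 <= n`!%:R `^ theta :> R.
Proof. by rewrite ler_powR // ler1n fact_gt0. Qed.

Let scale_le (k c : R) n (g : R) : 0 <= k -> k <= B -> 0 <= g -> g <= n`!%:R `^ theta ->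
  0 <= c -> k ^+ n * (g * c) <= B ^+ n * n`!%:R `^ theta * c.
Proof.
move=> k0 kB g0 gl c0; rewrite mulrA ler_wpM2r // ler_pM ?exprn_ge0 //.
by rewrite lerXn2r // nnegrE // ltW // packet_base_gt0.
Qed.

Let gauss_part (s : R) n : 0 <= s -> s ^+ n <= B ^+ n * n`!%:R `^ theta * expR (s ^+ 2 / 8).
Proof.
(* The parameter 1/2 leaves exp(s^2/8). This factor arises twice, from the power of t and from the
   derivative, and the product exp(s^2/4) is still beaten by the Gaussian exp(-s^2/2). *)
move=> s0; have h2 : 0 < 2^-1 :> R by rewrite invr_gt0.
apply: le_trans (pow_le_sqrt_fact_exp n h2 s0) _; rewrite invrK.
have -> : (2^-1 * s) ^+ 2 / 2 = s ^+ 2 / 8 by field.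
apply: scale_le; rewrite ?powR_ge0 ?expR_ge0 //.
by rewrite /B -addrA lerDl addr_ge0 // ltW.
Qed.

Let exp_part (r : R) n : `|r| ^+ n <= B ^+ n * n`!%:R `^ theta * E r.
Proof.
apply: le_trans (pow_le_fact_exp n t0 h0 (normr_ge0 r)) _.
apply: scale_le; rewrite ?powR_ge0 ?expR_ge0 ?(ltW i0) //.
by rewrite /B addrAC lerDr addr_ge0 // ltW.
Qed.

Let sqrt_part n : Num.sqrt n%:R ^+ n <= B ^+ n * n`!%:R `^ theta.
Proof.
apply: le_trans (pow_le_sqrt_fact_exp n ltr01 (sqrtr_ge0 _)) _.
rewrite invr1 expr1n !mul1r sqr_sqrtr // expRM_natl mulrC.
apply: le_trans (_ : A ^+ n * (n`!%:R `^ 2^-1 * 1) <= _); first by rewrite mulr1.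
apply: le_trans (scale_le (ltW A0) _ (powR_ge0 _ _) (fact_le n) ler01) _.
  by rewrite /B lerDr addr_ge0 // ltW.
by rewrite mulr1.
Qed.

(** Powers of t - p are paid for by the Gaussian, powers of [p] and [q] by the two exponentials. The
    4 comes from splitting a sum of three terms by two applications of [exprD_le]; the 6 is 2 times
    3, from bounding sums of two and of three numbers at least 1 by multiples of products. *)
Lemma packet1_weight (p q t : R) (a n : nat) :
  `|t| ^+ a * normc (packet1 p q n t) <=
  6 * (E p * E q) * ((4 * B) ^+ (a + n) * (a`! * n`!)%:R `^ theta).
Proof.
set s := `|t - p|; have s0 : 0 <= s by exact: normr_ge0.
set e8 := expR (s ^+ 2 / 8).
have e1 : 1 <= e8 by rewrite -expR0 ler_expR divr_ge0 // sqr_ge0.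
have E1 (r : R) : 1 <= E r by rewrite -expR0 ler_expR mulr_ge0 ?powR_ge0 // ltW.
have B0 := packet_base_gt0.
pose W m : R := B ^+ m * m`!%:R `^ theta.
have W0 m : 0 <= W m by rewrite mulr_ge0 ?powR_ge0 // exprn_ge0 // ltW.
have H1 : `|t| ^+ a <= 4 ^+ a * (W a * (2 * (e8 * E p))).
  have ts : `|t| <= s + `|p| by rewrite -[t in `|t|](subrK p); exact: ler_normD.
  apply: le_trans (_ : (s + `|p|) ^+ a <= _); first by rewrite lerXn2r // nnegrE // addr_ge0.
  apply: le_trans (exprD_le a s0 (normr_ge0 p)) _.
  apply: ler_pM; rewrite ?exprn_ge0 ?addr_ge0 ?exprn_ge0 //.
    by rewrite lerXn2r ?nnegrE ?ler0n ?ler_nat.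
  apply: le_trans (lerD (gauss_part a s0) (exp_part p a)) _.
  rewrite -mulrDr; apply: ler_wpM2l; first exact: W0.
  by have [? _] := ge1_add_le e1 (E1 p).
have H2 : normc (packet1 p q n t) <= 4 ^+ n * (W n * (3 * (e8 * E q))) * expR (- (s ^+ 2 / 2)).
  apply: le_trans (packet1_bound p q n t) _.
  rewrite -/s -[X in X ^+ 2 / 2]/(t - p) -[(t - p) ^+ 2]real_normK ?num_real // -/s.
  apply: ler_wpM2r; first exact: expR_ge0.
  have q0 := normr_ge0 q; have n0 := sqrtr_ge0 (n%:R : R).
  rewrite -addrA; apply: le_trans (exprD_le n s0 (addr_ge0 q0 n0)) _.
  apply: le_trans (_ : 4 ^+ n * (s ^+ n + `|q| ^+ n + Num.sqrt n%:R ^+ n) <= _).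
    have -> : 4 = 2 * 2 :> R by ring.
    rewrite exprMn -mulrA; apply: ler_wpM2l; first by rewrite exprn_ge0.
    rewrite -addrA mulrDr; apply: lerD; last exact: exprD_le.
    by rewrite ler_peMl ?exprn_ge0 // exprn_ege1 // ler1n.
  apply: ler_wpM2l; first by rewrite exprn_ge0.
  apply: le_trans (lerD (lerD (gauss_part n s0) (exp_part q n)) (sqrt_part n)) _.
  rewrite -mulrDr -[X in _ + X]mulr1 -mulrDr; apply: ler_wpM2l; first exact: W0.
  by have [_ ?] := ge1_add_le e1 (E1 q).
apply: le_trans (ler_pM _ (normc_ge0 _) H1 H2) _; first exact: exprn_ge0.
have -> : 4 ^+ a * (W a * (2 * (e8 * E p))) *
    (4 ^+ n * (W n * (3 * (e8 * E q))) * expR (- (s ^+ 2 / 2))) =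
  6 * (E p * E q) * ((4 ^+ a * W a) * (4 ^+ n * W n)) * (e8 * e8 * expR (- (s ^+ 2 / 2))).
  ring.
rewrite -[leRHS]mulr1; apply: ler_pM.
- by do ![exact: W0 | exact: exprn_ge0 | exact: expR_ge0 | exact: ler0n | apply: mulr_ge0].
- by do ![exact: expR_ge0 | apply: mulr_ge0].
- rewrite le_eqVlt; apply/orP; left; apply/eqP; congr (_ * _).
  by rewrite /W exprMn !exprD natrM powRM //; ring.
rewrite /e8 -!expRD expR_le1.
have := sqr_ge0 s; lra.
Qed.

End Packet1Weight.

(** * Wave packets in several variables *)

Section WavePacketJet.
Context {R : realType}.
Variable d : nat.
Implicit Types (x xi y : 'rV[R]_d).

Lemma edot_ge0 x : 0 <= edot x x.
Proof. by apply: sumr_ge0 => i _; rewrite -expr2 sqr_ge0. Qed.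

Lemma enorm_sqr x : enorm x ^+ 2 = \sum_(i < d) (x 0 i) ^+ 2.
Proof. by rewrite sqr_sqrtr ?edot_ge0 //; apply: eq_bigr => i _; rewrite expr2. Qed.

Lemma enorm_ge0 x : 0 <= enorm x.
Proof. exact: sqrtr_ge0. Qed.

Lemma coord_le_enorm x i : `|x 0 i| <= enorm x.
Proof.
rewrite -sqrtr_sqr ler_wsqrtr // /edot (bigD1 i) //= -expr2 lerDl.
by apply: sumr_ge0 => j _; rewrite -expr2 sqr_ge0.
Qed.

Definition packet x xi (b : 'I_d -> nat) y : R[i] :=
  \prod_(i < d) packet1 (x 0 i) (xi 0 i) (b i) (y 0 i).

Lemma wave_packetE x xi : packet x xi (@mi0 d) = wave_packet x xi.
Proof.
apply/funext => y; rewrite /packet /mi0 /= big_split /= -rmorph_prod -expR_sum.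
rewrite /wave_packet enorm_sqr /edot sumrN mulr_suml; congr (_ * _).
  by congr ((expR (- _))%:C); apply: eq_bigr => i _; rewrite !mxE.
rewrite (big_morph (fun t : R => cos t -i* sin t) (id1 := 1) (op1 := *%R)) //.
  move=> s t; rewrite cosD sinD; apply/eqP; rewrite eq_complex /=.
  by apply/andP; split; apply/eqP; ring.
by rewrite cos0 sin0 oppr0.
Qed.

Lemma packet_cderive x xi b j y :
  is_cderive (packet x xi b) y (delta_mx 0 j) (packet x xi (mi_succ j b) y).
Proof.
have P c : packet x xi c = fun y => packet1 (x 0 j) (xi 0 j) (c j) (y 0 j) *
    \prod_(i < d | i != j) packet1 (x 0 i) (xi 0 i) (c i) (y 0 i).
  by apply/funext => z; rewrite /packet (bigD1 j).
rewrite [in X in is_cderive X]P P.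
have -> : mi_succ j b j = (b j).+1 by rewrite /mi_succ eqxx addn1.
rewrite -[X in is_cderive _ _ _ X]addr0.
set r := \prod_(i < d | _) packet1 _ _ (mi_succ _ _ _) _.
have -> : r = \prod_(i < d | i != j) packet1 (x 0 i) (xi 0 i) (b i) (y 0 i).
  by apply: eq_bigr => i ij; rewrite /mi_succ (negbTE ij) addn0.
rewrite -[in X in _ + X](mulr0 (packet1 (x 0 j) (xi 0 j) (b j) (y 0 j))).
apply: is_cderiveM.
  apply: is_cderive_reparam (packet1_cderive _ _ _ _) => h.
  by rewrite !mxE !eqxx.
apply: is_cderive_cst_along => h; apply: eq_bigr => i ij.
by rewrite !mxE eqxx (negbTE ij) mulr0 add0r.
Qed.

Lemma normc_prod (F : 'I_d -> R[i]) : normc (\prod_(i < d) F i) = \prod_(i < d) normc (F i).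
Proof. by apply: big_morph; [exact: normcM|exact: normc1]. Qed.

Lemma powR_natr_prod (theta : R) (n : 'I_d -> nat) :
  \prod_(i < d) ((n i)%:R `^ theta) = (\prod_(i < d) n i)%N%:R `^ theta.
Proof.
rewrite (big_morph (fun m : nat => (m%:R : R) `^ theta) (id1 := 1) (op1 := *%R)) //.
  by move=> m k; rewrite natrM powRM.
by rewrite powR1.
Qed.

Lemma packet_weight (theta h : R) x xi a b y : 2^-1 <= theta -> 0 < h ->
  normc ((monom a y)%:C * packet x xi b y) <=
  6 ^+ d * expR (theta * h `^ theta^-1 * d%:R *
                 (enorm x `^ theta^-1 + enorm xi `^ theta^-1))
  * gs_weight theta (4 * packet_base h) a b.
Proof.
move=> ht h0; have t0 : 0 < theta by apply: lt_le_trans ht; rewrite invr_gt0.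
have B0 := packet_base_gt0 h0.
rewrite normcM normc_real /monom normr_prod normc_prod -big_split /=.
apply: le_trans (_ : \prod_(i < d) (6 * (expR (theta * (h * `|x 0 i|) `^ theta^-1) *
    expR (theta * (h * `|xi 0 i|) `^ theta^-1)) *
    ((4 * packet_base h) ^+ (a i + b i) * ((a i)`! * (b i)`!)%:R `^ theta)) <= _).
  apply: ler_prod => i _; rewrite mulr_ge0 ?normc_ge0 //= normrX.
  exact: packet1_weight.
rewrite !big_split /= prodr_const card_ord; apply: ler_pM.
- do ![exact: exprn_ge0 | apply: mulr_ge0 | apply: prodr_ge0 => ? _ | exact: expR_ge0].
- do ![exact: powR_ge0 | apply: mulr_ge0 | apply: prodr_ge0 => ? _ | apply: exprn_ge0];
  by rewrite // ltW.
- apply: ler_wpM2l; first by rewrite exprn_ge0.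
  have S (z : 'rV[R]_d) : \prod_(i < d) expR (theta * (h * `|z 0 i|) `^ theta^-1) <=
      expR (theta * h `^ theta^-1 * d%:R * enorm z `^ theta^-1).
    rewrite -expR_sum ler_expR [_ * d%:R * _]mulrAC mulr_natr.
    rewrite -[X in _ *+ X]card_ord -sumr_const; apply: ler_sum => i _.
    rewrite powRM ?(ltW h0) // mulrA ler_wpM2l ?mulr_ge0 ?powR_ge0 ?(ltW t0) //.
    rewrite ge0_ler_powR ?nnegrE ?enorm_ge0 ?coord_le_enorm //.
    by rewrite invr_ge0 ltW.
  rewrite mulrDr expRD; apply: ler_pM => //; apply: prodr_ge0 => ? _; exact: expR_ge0.
by rewrite prodrXr powR_natr_prod /gs_weight /mi_deg /mi_fact !big_split.
Qed.

(** The order of quantifiers is the point: [C] depends on [delta] but not on the base point, so one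
    bound of a functional on one step controls all packets. *)
Lemma wave_packet_jet (theta delta : R) : 2^-1 <= theta -> 0 < delta ->
  exists C K : R, [/\ 0 < C, 0 < K & forall x xi,
    gs_jet theta C
      (K * expR (delta * (enorm x `^ theta^-1 + enorm xi `^ theta^-1)))
      (wave_packet x xi) (packet x xi)].
Proof.
move=> ht de0; have t0 : 0 < theta by apply: lt_le_trans ht; rewrite invr_gt0.
have td0 : 0 < theta * (d%:R + 1) by rewrite mulr_gt0 // ltr_wpDl.
(* The solution of theta h^(1/theta) (d + 1) = delta; taking d + 1 instead of d avoids a zero
   divisor in dimension 0. *)
pose h := (delta / (theta * (d%:R + 1))) `^ theta.
have h0 : 0 < h by rewrite powR_gt0 // divr_gt0.
have hE : h `^ theta^-1 = delta / (theta * (d%:R + 1)).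
  by rewrite /h -powRrM mulfV ?gt_eqF // powRr1 // ltW // divr_gt0.
have hd : theta * h `^ theta^-1 * d%:R <= delta.
  rewrite hE mulrAC mulrCA -[leRHS]mulr1 ler_wpM2l ?(ltW de0) //.
  by rewrite ler_pdivrMr // mul1r ler_wpM2l ?(ltW t0) // lerDl.
exists (4 * packet_base h), (6 ^+ d); split.
- by rewrite mulr_gt0 // packet_base_gt0.
- by rewrite exprn_gt0.
move=> x xi; split; first exact: wave_packetE.
  by move=> b i y; exact: packet_cderive.
move=> a b y; apply: le_trans (packet_weight x xi a b y ht h0) _.
apply: ler_wpM2r; first by rewrite ltW // gs_weight_gt0 // mulr_gt0 // packet_base_gt0.
apply: ler_wpM2l; first by rewrite exprn_ge0.
by rewrite ler_expR ler_wpM2r // addr_ge0 // powR_ge0.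
Qed.

Lemma gs_dual_packet_growth (theta : R) (u : ('rV[R]_d -> R[i]) -> R[i]) (delta : R) :
  2^-1 <= theta -> gs_dual theta u -> 0 < delta ->
  exists2 K : R, 0 < K & forall x xi, normc (u (wave_packet x xi)) <=
    K * expR (delta * (enorm x `^ theta^-1 + enorm xi `^ theta^-1)).
Proof.
move=> ht /gs_dualP[_ ub] de0.
have [C [K [C0 K0 HJ]]] := wave_packet_jet ht de0.
have [M M0 HM] := ub C C0; exists (M * K) => [|x xi]; first by rewrite mulr_gt0.
by rewrite -mulrA; apply: HM (HJ x xi); rewrite mulr_gt0 // expR_gt0.
Qed.

Lemma wave_packet_space (theta : R) x xi : 2^-1 <= theta -> gs_space theta (wave_packet x xi).
Proof.
move=> ht; have [C [K [C0 K0 HJ]]] := wave_packet_jet ht ltr01.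
by apply: (gs_space_jet C0 _ (HJ x xi)); rewrite mulr_gt0 // expR_gt0.
Qed.

End WavePacketJet.

(** * Decay in cones *)

Section PhaseSpaceNorms.
Context {R : realType}.
Variable d : nat.
Implicit Types (q : 'rV[R]_d * 'rV[R]_d) (x : 'rV[R]_d).

Definition phase_weight (theta : R) q : R :=
  enorm q.1 `^ theta^-1 + enorm q.2 `^ theta^-1.

Lemma norm_le_enorm x : `|x| <= enorm x.
Proof.
have -> : `|x| = mx_norm x by [].
rewrite mx_normrE; apply: bigmax_le; first exact: enorm_ge0.
by move=> [i j] _ /=; rewrite (ord1 i) coord_le_enorm.
Qed.

Lemma enorm_le_norm x : enorm x <= (d%:R + 1) * `|x|.
Proof.
rewrite -(ler_pXn2r (n := 2)) ?nnegrE ?enorm_ge0 // ?mulr_ge0 ?addr_ge0 //.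
rewrite enorm_sqr; apply: (@le_trans _ _ (\sum_(i < d) `|x| ^+ 2)).
  apply: ler_sum => i _; rewrite -[leLHS]real_normK ?num_real //.
  by rewrite lerXn2r ?nnegrE // coord_le_norm.
rewrite sumr_const card_ord -[leLHS]mulr_natl exprMn ler_wpM2r ?sqr_ge0 //.
have := ler0n R d; nra.
Qed.

(** With [phase_weight_le], this makes the weight comparable to |q|^(1/theta), so that cones may be
    cut out by the library norm although decay is measured by Euclidean norms. *)
Lemma phase_weight_ge (theta : R) q : 0 < theta -> `|q| `^ theta^-1 <= phase_weight theta q.
Proof.
move=> t0; have i0 : 0 <= theta^-1 by rewrite invr_ge0 ltW.
rewrite prod_normE; case: (leP `|q.1| `|q.2|) => _.
  apply: (@le_trans _ _ (enorm q.2 `^ theta^-1)); last by rewrite lerDr powR_ge0.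
  by rewrite ge0_ler_powR ?nnegrE ?enorm_ge0 ?norm_le_enorm.
apply: (@le_trans _ _ (enorm q.1 `^ theta^-1)); last by rewrite lerDl powR_ge0.
by rewrite ge0_ler_powR ?nnegrE ?enorm_ge0 ?norm_le_enorm.
Qed.

Lemma phase_weight_le (theta r : R) q : 0 < theta -> `|q| <= r ->
  phase_weight theta q <= 2 * (d%:R + 1) `^ theta^-1 * r `^ theta^-1.
Proof.
move=> t0 qr; have i0 : 0 <= theta^-1 by rewrite invr_ge0 ltW.
have r0 : 0 <= r by exact: le_trans qr.
have d0 : 0 <= d%:R + 1 :> R by rewrite addr_ge0.
rewrite -mulrA -powRM // mulr2n mulrDl mul1r.
have S x : `|x| <= `|q| -> enorm x `^ theta^-1 <= ((d%:R + 1) * r) `^ theta^-1.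
  move=> xq; rewrite ge0_ler_powR ?nnegrE ?enorm_ge0 ?mulr_ge0 //.
  apply: le_trans (enorm_le_norm x) _; rewrite ler_wpM2l //; exact: le_trans qr.
by apply: lerD; apply: S; rewrite prod_normE le_max lexx ?orbT.
Qed.

End PhaseSpaceNorms.

Lemma ball_nonexpansive_continuous (R : realType) (V W : pseudoMetricType R) (f : V -> W) :
  (forall (x : V) (e : R) y, ball x e y -> ball (f x) e (f y)) -> continuous f.
Proof.
move=> H x; apply/cvg_ballP => e e0.
by apply: filterS (nbhsx_ballx x e e0) => y; exact: H.
Qed.

(* On a conic neighbourhood where [|pi2 q| < K |pi1 q|] the exponential decay
   in [pi1 q] dominates the subexponential growth in [pi2 q]. *)
Lemma conic_decay (R : realType) (theta : R) (d d1 d2 : nat)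
    (pi1 : 'rV[R]_d * 'rV[R]_d -> 'rV[R]_d1 * 'rV[R]_d1)
    (pi2 : 'rV[R]_d * 'rV[R]_d -> 'rV[R]_d2 * 'rV[R]_d2)
    (U : 'rV[R]_d1 * 'rV[R]_d1 -> R) (V : 'rV[R]_d2 * 'rV[R]_d2 -> R)
    (G1 : set ('rV[R]_d1 * 'rV[R]_d1)) p (C e : R) :
  0 < theta -> continuous pi1 -> continuous pi2 ->
  (forall t q, pi1 (t *: q) = t *: pi1 q) -> (forall t q, pi2 (t *: q) = t *: pi2 q) ->
  (forall q, `|q| <= `|pi1 q| + `|pi2 q|) ->
  (forall q, 0 <= V q) -> (forall q, 0 <= U q) ->
  open G1 -> conic G1 -> G1 (pi1 p) -> 0 < C -> 0 < e ->
  (forall q, G1 q -> U q <= C * expR (- (e * phase_weight theta q))) ->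
  (forall delta, 0 < delta -> exists2 K : R, 0 < K & forall q,
      V q <= K * expR (delta * phase_weight theta q)) ->
  exists G : set ('rV[R]_d * 'rV[R]_d), [/\ open G, conic G, G p &
    exists C e : R, [/\ 0 < C, 0 < e & forall q, G q ->
      U (pi1 q) * V (pi2 q) <= C * expR (- (e * phase_weight theta q))]].
Proof.
move=> t0 c1 c2 h1 h2 hn V0 U0 oG [G0 Gh] Gp C0 e0 HU HV.
have np : 0 < `|pi1 p|.
  by rewrite normr_gt0; apply/eqP => E; apply: G0; rewrite -E.
(* Exceeding the ratio at [p] by 1 puts [p] strictly inside the cone and keeps [k] positive when
   [pi2 p] vanishes. The denominator is nonzero because the conic set [G1] avoids 0. *)
pose k := `|pi2 p| / `|pi1 p| + 1.
have k0 : 0 < k by rewrite ltr_wpDl // divr_ge0.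
pose G := pi1 @^-1` G1 `&` [set q | `|pi2 q| < k * `|pi1 q|].
exists G; split.
- apply: openI; first by apply: open_comp => // q _; exact: c1.
  have -> : [set q | `|pi2 q| < k * `|pi1 q|] =
      (fun q => k * `|pi1 q| - `|pi2 q|) @^-1` [set r | 0 < r].
    by apply/seteqP; split => q /=; rewrite subr_gt0.
  apply: open_comp; last exact: open_gt.
  move=> q _; apply: cvgB; last by apply: cvg_norm; exact: c2.
  by apply: cvgMl_tmp; apply: cvg_norm; exact: c1.
- split=> [[] /= |t q t0' [/= Gq kq]].
    by have := h1 0 0; rewrite !scale0r => ->.
  split => /=; first by rewrite h1; exact: Gh.
  by rewrite h1 h2 !normrZ mulrCA ltr_pM2l // normr_gt0 gt_eqF.
- split => //=; rewrite mulrDl mul1r divfK ?gt_eqF // ltrDl //.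
pose c := 2 * (d2%:R + 1) `^ theta^-1 * k `^ theta^-1.
pose c' := 2 * (d%:R + 1) `^ theta^-1 * (1 + k) `^ theta^-1.
have pos (n : nat) : 0 < (n%:R + 1) `^ theta^-1 :> R by rewrite powR_gt0 // ltr_wpDl.
have c_gt0 : 0 < c by rewrite !mulr_gt0 // powR_gt0.
have c'_gt0 : 0 < c' by rewrite !mulr_gt0 // powR_gt0 // addr_gt0.
(* Half of the rate [e] pays for the growth in [pi2 q], whose weight is at most [c] times that of
   [pi1 q]; the other half, divided by [c'], is the decay rate left for [q]. *)
have [K K0 HK] := HV (e / (2 * c)) ltac:(by rewrite divr_gt0 // mulr_gt0).
exists (C * K), (e / (2 * c')); split; first exact: mulr_gt0.
  by rewrite divr_gt0 // mulr_gt0.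
move=> q [/= Gq kq].
have w2 : phase_weight theta (pi2 q) <= c * phase_weight theta (pi1 q).
  apply: le_trans (phase_weight_le t0 (ltW kq)) _.
  rewrite powRM ?(ltW k0) // mulrA ler_wpM2l ?(ltW c_gt0) //.
  exact: phase_weight_ge.
have w0 : phase_weight theta q <= c' * phase_weight theta (pi1 q).
  have qk : `|q| <= (1 + k) * `|pi1 q|.
    by apply: le_trans (hn q) _; rewrite mulrDl mul1r lerD2l ltW.
  apply: le_trans (phase_weight_le t0 qk) _.
  rewrite powRM ?addr_ge0 ?(ltW k0) // mulrA ler_wpM2l ?(ltW c'_gt0) //.
  exact: phase_weight_ge.
apply: le_trans (ler_pM (U0 _) (V0 _) (HU _ Gq) (HK _)) _.
rewrite mulrACA -expRD; apply: ler_wpM2l; first by rewrite mulr_ge0 // ltW.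
rewrite ler_expR.
set w1 := phase_weight theta (pi1 q) in w2 w0 *.
have L2 : e / (2 * c) * phase_weight theta (pi2 q) <= e / 2 * w1.
  have -> : e / 2 * w1 = e / (2 * c) * (c * w1) by field; rewrite gt_eqF.
  by rewrite ler_wpM2l // ltW // divr_gt0 // mulr_gt0.
have L0 : e / (2 * c') * phase_weight theta q <= e / 2 * w1.
  have -> : e / 2 * w1 = e / (2 * c') * (c' * w1) by field; rewrite gt_eqF.
  by rewrite ler_wpM2l // ltW // divr_gt0 // mulr_gt0.
lra.
Qed.

(** * Splitting phase space and packets into the two factors *)

Section Projections.
Context {R : realType}.
Variables (d1 d2 : nat).
Local Notation P := ('rV[R]_(d1 + d2) * 'rV[R]_(d1 + d2))%type.

Definition cotangent_proj1 (q : P) : 'rV[R]_d1 * 'rV[R]_d1 := (lsubmx q.1, lsubmx q.2).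
Definition cotangent_proj2 (q : P) : 'rV[R]_d2 * 'rV[R]_d2 := (rsubmx q.1, rsubmx q.2).

Lemma cotangent_mergeK q : cotangent_merge (cotangent_proj1 q, cotangent_proj2 q) = q.
Proof. by case: q => x xi; rewrite /cotangent_merge /= !hsubmxK. Qed.

Lemma cotangent_proj1_continuous : continuous cotangent_proj1.
Proof.
apply: ball_nonexpansive_continuous => -[x xi] e [y eta] [[e0 B1] [_ B2]].
by split; split => // i j; rewrite !mxE; [exact: B1|exact: B2].
Qed.

Lemma cotangent_proj2_continuous : continuous cotangent_proj2.
Proof.
apply: ball_nonexpansive_continuous => -[x xi] e [y eta] [[e0 B1] [_ B2]].
by split; split => // i j; rewrite !mxE; [exact: B1|exact: B2].
Qed.

Lemma cotangent_proj1Z (t : R) q : cotangent_proj1 (t *: q) = t *: cotangent_proj1 q.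
Proof. by rewrite /cotangent_proj1 /= !linearZ. Qed.

Lemma cotangent_proj2Z (t : R) q : cotangent_proj2 (t *: q) = t *: cotangent_proj2 q.
Proof. by rewrite /cotangent_proj2 /= !linearZ. Qed.

Lemma norm_row_mx_le (x : 'rV[R]_(d1 + d2)) : `|x| <= `|lsubmx x| + `|rsubmx x|.
Proof.
have {1}-> : `|x| = mx_norm x by [].
rewrite mx_normrE; apply: bigmax_le => [|[i j] _ /=]; first by rewrite addr_ge0.
rewrite (ord1 i) -{1}(hsubmxK x); case: (split_ordP j) => k ->.
  by rewrite row_mxEl ler_wpDr // coord_le_norm.
by rewrite row_mxEr ler_wpDl // coord_le_norm.
Qed.

Lemma norm_cotangent_proj (q : P) :
  `|q| <= `|cotangent_proj1 q| + `|cotangent_proj2 q|.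
Proof.
rewrite [leLHS]prod_normE ge_max; apply/andP; split.
  apply: le_trans (norm_row_mx_le _) _; apply: lerD;
  by rewrite [leRHS]prod_normE le_max lexx.
apply: le_trans (norm_row_mx_le _) _; apply: lerD;
by rewrite [leRHS]prod_normE le_max lexx orbT.
Qed.

Lemma wave_packet_row (x xi : 'rV[R]_(d1 + d2)) :
  wave_packet x xi = fun z => wave_packet (lsubmx x) (lsubmx xi) (lsubmx z) *
    wave_packet (rsubmx x) (rsubmx xi) (rsubmx z).
Proof.
apply/funext => z; rewrite -!wave_packetE /packet big_split_ord /=.
by congr (_ * _); apply: eq_bigr => i _; rewrite !mxE.
Qed.

Lemma tensor_wave_packet (theta : R) u v q : 2^-1 <= theta ->
  gs_dual theta u -> gs_dual theta v ->
  normc (tensor u v (wave_packet q.1 q.2)) =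
  normc (u (wave_packet (cotangent_proj1 q).1 (cotangent_proj1 q).2)) *
  normc (v (wave_packet (cotangent_proj2 q).1 (cotangent_proj2 q).2)).
Proof.
move=> ht Hu Hv; rewrite wave_packet_row (tensorE Hu Hv) ?normcM //;
exact: wave_packet_space.
Qed.

End Projections.

Lemma WFgl_decay (R : realType) (theta : R) (d : nat)
    (u : ('rV[R]_d -> R[i]) -> R[i]) (G : set ('rV[R]_d * 'rV[R]_d)) p :
  WFgl theta u `<=` G -> ~ (G `|` [set 0]) p ->
  exists G' : set ('rV[R]_d * 'rV[R]_d), [/\ open G', conic G', G' p &
    exists C e : R, [/\ 0 < C, 0 < e & forall q, G' q ->
      normc (u (wave_packet q.1 q.2)) <= C * expR (- (e * phase_weight theta q))]].
Proof.
move=> WG nG; have Wp : ~ WFgl theta u p by move=> /WG Gp; apply: nG; left.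
have p0 : p <> 0 by move=> E; apply: nG; right.
apply: contrapT => nH; apply: Wp; split => // -[G' [oG cG Gp [C [e [C0 e0 H]]]]].
apply: nH; exists G'; split => //; exists C, e; split => // -[x xi]; exact: H.
Qed.

Theorem proposition3p12 (R : realType) (theta : R) (d1 d2 : nat)
    (htheta : 2^-1 <= theta < 1)
    (G1 : set ('rV[R]_d1 * 'rV[R]_d1)) (G2 : set ('rV[R]_d2 * 'rV[R]_d2))
    (hG1 : closed_cone G1) (hG2 : closed_cone G2)
    (u : ('rV[R]_d1 -> R[i]) -> R[i]) (v : ('rV[R]_d2 -> R[i]) -> R[i])
    (hu : gs_dual_wf theta G1 u) (hv : gs_dual_wf theta G2 v) :
  gs_dual_wf theta (cone_prod G1 G2) (tensor u v).
Proof.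
have [ht _] := andP htheta.
have t0 : 0 < theta by apply: lt_le_trans ht; rewrite invr_gt0.
have [Du Wu] := hu; have [Dv Wv] := hv.
split; first exact: gs_dual_tensor.
move=> p [p0 Wp]; apply: contrapT => nG; apply: Wp.
suff [G [oG cG Gp [C [e [C0 e0 H]]]]] :
    exists G : set ('rV[R]_(d1 + d2) * 'rV[R]_(d1 + d2)), [/\ open G, conic G, G p &
    exists C e : R, [/\ 0 < C, 0 < e & forall q, G q ->
      normc (tensor u v (wave_packet q.1 q.2)) <=
      C * expR (- (e * phase_weight theta q))]].
  by exists G; split => //; exists C, e; split => // x xi /H.
have growth d (w : ('rV[R]_d -> R[i]) -> R[i]) : gs_dual theta w ->
    forall delta, 0 < delta -> exists2 K : R, 0 < K & forall q,
      normc (w (wave_packet q.1 q.2)) <= K * expR (delta * phase_weight theta q).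
  move=> Dw delta de0; have [K K0 HK] := gs_dual_packet_growth ht Dw de0.
  by exists K => // q; exact: HK.
have [n1|n1] := pselect ((G1 `|` [set 0]) (cotangent_proj1 p)); last first.
  have [G' [oG cG Gp [C [e [C0 e0 H]]]]] := WFgl_decay Wu n1.
  have [G [? ? ? [C' [e' [? ? HG]]]]] := conic_decay t0
    (@cotangent_proj1_continuous R d1 d2) (@cotangent_proj2_continuous R d1 d2)
    (@cotangent_proj1Z _ _ _) (@cotangent_proj2Z _ _ _) (@norm_cotangent_proj R d1 d2)
    (fun=> normc_ge0 _) (fun=> normc_ge0 _) oG cG Gp C0 e0 H (growth _ _ Dv).
  exists G; split => //; exists C', e'; split => // q Gq.
  by rewrite (tensor_wave_packet q ht Du Dv); exact: HG.
(* If both components lay in the enlarged cones, the nonzero point [p] would belong to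
   [cone_prod]. *)
have n2 : ~ (G2 `|` [set 0]) (cotangent_proj2 p).
  move=> n2; apply: nG; split => //.
  by exists (cotangent_proj1 p, cotangent_proj2 p) => //; exact: cotangent_mergeK.
have [G' [oG cG Gp [C [e [C0 e0 H]]]]] := WFgl_decay Wv n2.
(* [tensor] treats [u] and [v] unequally, but on packets it is a product of two numbers. Hence
   [conic_decay], stated for abstract projections, applies with the factors exchanged. *)
have hn q : `|q| <= `|@cotangent_proj2 R d1 d2 q| + `|cotangent_proj1 q|.
  by rewrite addrC; exact: norm_cotangent_proj.
have [G [? ? ? [C' [e' [? ? HG]]]]] := conic_decay t0
  (@cotangent_proj2_continuous R d1 d2) (@cotangent_proj1_continuous R d1 d2)
  (@cotangent_proj2Z _ _ _) (@cotangent_proj1Z _ _ _) hn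
  (fun=> normc_ge0 _) (fun=> normc_ge0 _) oG cG Gp C0 e0 H (growth _ _ Du).
exists G; split => //; exists C', e'; split => // q Gq.
by rewrite (tensor_wave_packet q ht Du Dv) mulrC; exact: HG.
Qed.
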